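(* It is undecidable, given a finite set of rotations of the $3$-sphere $S^3\subset\mathbb{R}^4$, each specified by a pair $(a,b)$ of unit quaternions with rational coefficients acting by $q\mapsto a\,q\,b^{-1}$, whether the semigroup generated by these rotations (under composition) is a group.
   Context: A point $x=(x_1,x_2,x_3,x_4)$ of the unit $3$-sphere is identified with the unit quaternion $x_1+x_2i+x_3j+x_4k$; a pair $(a,b)$ of unit quaternions determines the rotation $q\mapsto aqb^{-1}$ of $S^3$. *)

(* Defs.v *)
From Stdlib Require Import Reals QArith List Arith.

Record quat := Quat { qa : R; qb : R; qc : R; qd : R }.

Local Open Scope R_scope.

(* Hamilton product of x1 + x2 i + x3 j + x4 k *)
Definition qmul (x y : quat) : quat :=
  Quat (qa x * qa y - qb x * qb y - qc x * qc y - qd x * qd y)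
       (qa x * qb y + qb x * qa y + qc x * qd y - qd x * qc y)
       (qa x * qc y - qb x * qd y + qc x * qa y + qd x * qb y)
       (qa x * qd y + qb x * qc y - qc x * qb y + qd x * qa y).

Definition qnorm2 (x : quat) : R :=
  qa x * qa x + qb x * qb x + qc x * qc x + qd x * qd x.

Definition qinv (x : quat) : quat :=
  let n := / qnorm2 x in Quat (n * qa x) (- (n * qb x)) (- (n * qc x)) (- (n * qd x)).

Definition on_S3 (x : quat) : Prop := qnorm2 x = 1.

Definition rot (p : quat * quat) (x : quat) : quat :=
  qmul (qmul (fst p) x) (qinv (snd p)).

Fixpoint word_map (w : list (quat * quat)) (x : quat) : quat :=
  match w with
  | nil => x
  | p :: w' => rot p (word_map w' x)
  end.

Definition in_semigroup (G : list (quat * quat)) (f : quat -> quat) : Prop :=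
  exists w, w <> nil /\ incl w G /\ forall x, on_S3 x -> f x = word_map w x.

Definition semigroup_is_group (G : list (quat * quat)) : Prop :=
  (exists e, in_semigroup G e /\ forall x, on_S3 x -> e x = x) /\
  (forall f, in_semigroup G f ->
     exists g, in_semigroup G g /\
       forall x, on_S3 x -> g (f x) = x /\ f (g x) = x).

Record qquat := QQuat { ra : Q; rb : Q; rc : Q; rd : Q }.

Definition qquat_to_quat (x : qquat) : quat :=
  Quat (Q2R (ra x)) (Q2R (rb x)) (Q2R (rc x)) (Q2R (rd x)).

Definition instance := list (qquat * qquat).

Definition instance_gens (S : instance) : list (quat * quat) :=
  map (fun p => (qquat_to_quat (fst p), qquat_to_quat (snd p))) S.

Definition valid_instance (S : instance) : Prop :=
  Forall (fun p => on_S3 (qquat_to_quat (fst p)) /\ on_S3 (qquat_to_quat (snd p))) S.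

Local Close Scope R_scope.
Local Open Scope nat_scope.

Definition npair (n m : nat) : nat := (n + m) * (n + m + 1) / 2 + m.

Definition encZ (z : Z) : nat :=
  match z with
  | Z0 => 0
  | Zpos p => 2 * Pos.to_nat p - 1
  | Zneg p => 2 * Pos.to_nat p
  end.

Definition encQ (q : Q) : nat := npair (encZ (Qnum q)) (Pos.to_nat (Qden q) - 1).

Definition encQuat (x : qquat) : nat :=
  npair (npair (encQ (ra x)) (encQ (rb x))) (npair (encQ (rc x)) (encQ (rd x))).

Fixpoint encode (L : instance) : nat :=
  match L with
  | nil => 0
  | p :: L' => Datatypes.S (npair (npair (encQuat (fst p)) (encQuat (snd p))) (encode L'))
  end.

Inductive instr :=
| INC (r : nat)
| DEC (r : nat) (j : nat). (* if register r is 0 jump to j, else decrement it and go on *)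

Definition program := list instr.
Definition config := (nat * (nat -> nat))%type. (* program counter, registers *)

Definition update (f : nat -> nat) (r v : nat) : nat -> nat :=
  fun r' => if Nat.eqb r' r then v else f r'.

Definition step (P : program) (c : config) : option config :=
  let (pc, regs) := c in
  match nth_error P pc with
  | None => None
  | Some (INC r) => Some (S pc, update regs r (S (regs r)))
  | Some (DEC r j) =>
      match regs r with
      | O => Some (j, regs)
      | S k => Some (S pc, update regs r k)
      end
  end.

Fixpoint steps (P : program) (n : nat) (c : config) : config :=
  match n with
  | O => c
  | S n' => match step P c with None => c | Some c' => steps P n' c' end
  end.

Definition halted (P : program) (c : config) : Prop := step P c = None.

Definition init (x : nat) : config := (0, fun r => if Nat.eqb r 0 then x else 0).

Definition outputs (P : program) (x y : nat) : Prop :=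
  exists n, halted P (steps P n (init x)) /\ snd (steps P n (init x)) 0 = y.

Definition decides (P : program) (Prp : instance -> Prop) : Prop :=
  forall S, valid_instance S ->
    exists y, outputs P (encode S) y /\ (y <> 0 <-> Prp S).

(* Main.v *)
Require Import Defs.
From Stdlib Require Import Reals QArith Qreals List Arith ZArith Lia Lra Bool.
From Stdlib Require Import Setoid Morphisms Relations ClassicalEpsilon FunctionalExtensionality.
Import ListNotations.
Local Open Scope nat_scope.

(* Deciding the group property is reduced from the halting of counter machines. The quaternions u = (3+4i)/5 and v = (3+4j)/5 generate a free group: modulo 5 the integer quaternions become 2x2 matrices, the letters have rank one, and only inverse letters annihilate each other. So words may be used in place of quaternions.

A machine with program counter pc and registers r_i is coded by the number n = L prod p_i^(r_i) + pc, on which it acts by finitely many rules m j + r -> m' j + r'. In a group with generators x, t, d and one k for each rule, put T_n = x^n t x^-n; the relations k x^m = x^m' k, k T_r = T_r' k, [d,k] = 1 and [d,T_h] = 1 (h the final code) force d to commute with T_n as soon as n leads to h. Following Mihailova, the pairs (a,a) for letters and (lhs,rhs) for relations, with their inverses, generate the pairs of words that are equal in this group; one further generator tau = (T_n^-1 d T_n d^-1, 1) is added, and tau is invertible if the machine halts. If it does not, the group acts on configurations (and junk copies of the integers, on which Cantor-Bernstein provides the k) so that d and tau translate an additional integer coordinate, tau by a nonnegative function that is not zero; hence no product containing tau is trivial.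

The input x enters only through the relation x^(2^x) = y, with T_n = y^L t y^-L. Thus the instance for a machine D and an input x consists of two generators depending only on x and a tail depending only on D. If P decided the problem, let D on input x run P on the instance whose tail has code x, and halt if and only if P answers 0: applying D to the code of its own tail gives a contradiction. *)

(** * Words, and a free group of rational unit quaternions *)

Section Words.
Context {A : Type}.

Definition flip (l : A * bool) : A * bool := (fst l, negb (snd l)).
Definition winv (w : list (A * bool)) : list (A * bool) := rev (map flip w).

Lemma flip_flip l : flip (flip l) = l.
Proof. destruct l as [a []]; reflexivity. Qed.

Lemma winv_app u v : winv (u ++ v) = winv v ++ winv u.
Proof. unfold winv. now rewrite map_app, rev_app_distr. Qed.

Lemma winv_winv w : winv (winv w) = w.
Proof.
  unfold winv. rewrite map_rev, rev_involutive, map_map.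
  rewrite <- (map_id w) at 2. apply map_ext, flip_flip.
Qed.

Context {Y : Type} (act : A * bool -> Y -> Y).

Definition acts (w : list (A * bool)) (y : Y) : Y := fold_right act y w.

Lemma acts_app u v y : acts (u ++ v) y = acts u (acts v y).
Proof. apply fold_right_app. Qed.

Hypothesis act_flip : forall l y, act l (act (flip l) y) = y.

Lemma acts_winv_r w y : acts w (acts (winv w) y) = y.
Proof.
  revert y; induction w as [|l w IH]; intros y; [reflexivity|].
  change (l :: w) with ([l] ++ w). rewrite winv_app, !acts_app, IH. apply act_flip.
Qed.

Lemma acts_winv_l w y : acts (winv w) (acts w y) = y.
Proof. rewrite <- (winv_winv w) at 2. apply acts_winv_r. Qed.

End Words.

Definition word := list (nat * bool).
Definition fword := list (bool * bool).

(** * Integer quaternions and their reduction modulo 5 *)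

Record zquat := ZQuat { za : Z; zb : Z; zc : Z; zd : Z }.

Section IntegerQuaternions.
Local Open Scope Z_scope.

Definition zmul (x y : zquat) : zquat :=
  ZQuat (za x * za y - zb x * zb y - zc x * zc y - zd x * zd y)
        (za x * zb y + zb x * za y + zc x * zd y - zd x * zc y)
        (za x * zc y - zb x * zd y + zc x * za y + zd x * zb y)
        (za x * zd y + zb x * zc y - zc x * zb y + zd x * za y).

Definition zletter (l : bool * bool) : zquat :=
  let s := if snd l then 4 else -4 in
  if fst l then ZQuat 3 s 0 0 else ZQuat 3 0 s 0.

Definition zval (w : fword) : zquat := fold_right (fun l q => zmul (zletter l) q) (ZQuat 1 0 0 0) w.

(* The reduction of the integer quaternions modulo 5 to 2x2 matrices, with i = diag(2,-2) and j = [[0,1],[-1,0]], applied to a vector. *)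
Definition mv (q : zquat) (v : Z * Z) : Z * Z :=
  ((za q + 2 * zb q) * fst v + (zc q + 2 * zd q) * snd v,
   (2 * zd q - zc q) * fst v + (za q - 2 * zb q) * snd v).

(* Modulo 5 each of the four letters has rank one; this is its image, and the kernel of a letter is the image of its inverse. *)
Definition on_line (l : bool * bool) (v : Z * Z) : Prop :=
  match l with
  | (true, true) => snd v mod 5 = 0 /\ fst v mod 5 <> 0
  | (true, false) => fst v mod 5 = 0 /\ snd v mod 5 <> 0
  | (false, true) => (fst v - 3 * snd v) mod 5 = 0 /\ snd v mod 5 <> 0
  | (false, false) => (fst v - 2 * snd v) mod 5 = 0 /\ snd v mod 5 <> 0
  end.

(** Modulo 5 the kernel of [l] is the line of [flip l]. The four lines are distinct, so a nonzero
    vector on any other line has a nonzero image under [l]. *)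
Lemma on_line_mv l l' v : l' <> flip l -> on_line l' v -> on_line l (mv (zletter l) v).
Proof.
  destruct v as [x y], l as [[] []], l' as [[] []]; intros H;
    try (exfalso; apply H; reflexivity); clear H;
    cbv [on_line mv zletter fst snd za zb zc zd]; Z.div_mod_to_equations; lia.
Qed.

(** The matrices are multiplicative only modulo 5: for instance that of $i$ squares to $4=-1+5$. The
    witnesses collect these multiples of 5. *)
Lemma mv_mul p q v : exists s t,
  mv (zmul p q) v = (fst (mv p (mv q v)) + 5 * s, snd (mv p (mv q v)) + 5 * t).
Proof.
  destruct p as [a b c d], q as [a' b' c' d'], v as [x y]; unfold mv, zmul; cbn [za zb zc zd fst snd].
  exists (- (b * b' * x + d * d' * x + b * d' * y - d * b' * y)),
    (- (b * b' * y + d * d' * y + d * b' * x - b * d' * x)).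
  f_equal; ring.
Qed.

Lemma on_line_shift l v s t : on_line l v -> on_line l (fst v + 5 * s, snd v + 5 * t).
Proof.
  destruct v as [x y], l as [[] []]; cbv [on_line fst snd]; Z.div_mod_to_equations; lia.
Qed.

Fixpoint reduced (w : fword) : Prop :=
  match w with
  | l :: (l' :: _) as t => l' <> flip l /\ reduced t
  | _ => True
  end.

(** Starting from a vector on the line of the last letter, each further letter moves the vector to
    its own line, since it never follows its inverse. *)
Lemma reduced_zval l w : reduced (l :: w) -> exists v, on_line l (mv (zval (l :: w)) v).
Proof.
  revert l; induction w as [|l' w IH]; intros l.
  - intros _. exists (match l with (true, true) => (1, 0) | (true, false) => (0, 1)
      | (false, true) => (3, 1) | (false, false) => (2, 1) end).
    destruct l as [[] []]; vm_compute; split; congruence.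
  - intros [H1 H2]. destruct (IH _ H2) as [v Hv]. exists v.
    change (zval (l :: l' :: w)) with (zmul (zletter l) (zval (l' :: w))).
    destruct (mv_mul (zletter l) (zval (l' :: w)) v) as (s & t & ->).
    apply on_line_shift, (on_line_mv l l'); assumption.
Qed.

(** For a nonempty word the scalar is a multiple of 5, so its matrix vanishes modulo 5 and has no
    vector on a line in its image. *)
Lemma reduced_not_scalar w e : w <> [] -> reduced w ->
  zval w <> ZQuat (e * 5 ^ Z.of_nat (length w)) 0 0 0.
Proof.
  destruct w as [|l w]; [congruence|]. intros _ Hr He.
  destruct (reduced_zval _ _ Hr) as [[x y] Hv]. rewrite He in Hv.
  cbn [length] in Hv. rewrite Nat2Z.inj_succ, Z.pow_succ_r in Hv by lia.
  set (k := e * 5 ^ Z.of_nat (length w)) in *.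
  replace (e * (5 * 5 ^ Z.of_nat (length w))) with (5 * k) in Hv by (unfold k; ring).
  unfold mv in Hv; cbn [za zb zc zd fst snd] in Hv.
  replace ((5 * k + 2 * 0) * x + (0 + 2 * 0) * y) with ((k * x) * 5) in Hv by ring.
  replace ((2 * 0 - 0) * x + (5 * k - 2 * 0) * y) with ((k * y) * 5) in Hv by ring.
  destruct l as [[] []]; cbn [on_line fst snd] in Hv; rewrite ?Z.mod_mul in Hv by lia; destruct Hv; congruence.
Qed.

End IntegerQuaternions.

Lemma reduced_or_cancel (w : fword) :
  reduced w \/ exists u l v, w = u ++ l :: flip l :: v.
Proof.
  induction w as [|l w IH]; [left; exact I|].
  destruct IH as [IH | (u & m & v & ->)].
  - destruct w as [|l' w]; [left; exact I|].
    assert (D : {l' = flip l} + {l' <> flip l}) by (repeat decide equality).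
    destruct D as [-> | D].
    + right. exists [], l, w. reflexivity.
    + left. split; assumption.
  - right. exists (l :: u), m, v. reflexivity.
Qed.

(** * Freeness of the rational unit quaternions *)

Section RealQuaternions.
Local Open Scope R_scope.

Definition qscale (s : R) (x : quat) : quat := Quat (s * qa x) (s * qb x) (s * qc x) (s * qd x).
Definition qconj (x : quat) : quat := Quat (qa x) (- qb x) (- qc x) (- qd x).
Definition qone : quat := Quat 1 0 0 0.

Lemma qmul_assoc x y z : qmul x (qmul y z) = qmul (qmul x y) z.
Proof. unfold qmul; cbn; f_equal; ring. Qed.

Lemma qmul_1l x : qmul qone x = x.
Proof. destruct x; unfold qmul; cbn; f_equal; ring. Qed.

Lemma qmul_1r x : qmul x qone = x.
Proof. destruct x; unfold qmul; cbn; f_equal; ring. Qed.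

Lemma qnorm2_mul x y : qnorm2 (qmul x y) = qnorm2 x * qnorm2 y.
Proof. unfold qnorm2, qmul; cbn; ring. Qed.

Lemma on_S3_mul x y : on_S3 x -> on_S3 y -> on_S3 (qmul x y).
Proof. unfold on_S3; intros H H'. rewrite qnorm2_mul, H, H'. ring. Qed.

Lemma qinv_unit x : on_S3 x -> qinv x = qconj x.
Proof. unfold on_S3, qinv, qconj; intros ->. rewrite Rinv_1. f_equal; ring. Qed.

Lemma qconj_mul x y : qconj (qmul x y) = qmul (qconj y) (qconj x).
Proof. unfold qconj, qmul; cbn; f_equal; ring. Qed.

Lemma qmul_conj_r x : on_S3 x -> qmul x (qconj x) = qone.
Proof.
  unfold on_S3, qnorm2; intros H. unfold qmul, qconj, qone; cbn. f_equal; try ring.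
  rewrite <- H; ring.
Qed.

(** The denominator is the full power of 5, never reduced, so that equations between values become
    equations between integers. *)
Definition rval (w : fword) : quat :=
  let q := zval w in let n := 5 ^ length w in
  Quat (IZR (za q) / n) (IZR (zb q) / n) (IZR (zc q) / n) (IZR (zd q) / n).

Lemma rval_cons l w : rval (l :: w) = qmul (rval [l]) (rval w).
Proof.
  unfold rval. change (zval (l :: w)) with (zmul (zletter l) (zval w)).
  change (zval [l]) with (zmul (zletter l) (ZQuat 1 0 0 0)).
  cbn [length pow]. generalize (zval w); intros [a b c d].
  assert (H : 5 ^ length w <> 0) by (apply pow_nonzero; lra).
  destruct (zletter l) as [a' b' c' d'].
  unfold zmul, qmul; cbn.
  rewrite ?plus_IZR, ?minus_IZR, ?mult_IZR, ?opp_IZR, ?plus_IZR, ?minus_IZR, ?mult_IZR.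
  f_equal; field; assumption.
Qed.

Lemma rval_nil : rval [] = qone.
Proof. unfold rval, qone; cbn. f_equal; field. Qed.

Lemma rval_app u v : rval (u ++ v) = qmul (rval u) (rval v).
Proof.
  induction u as [|l u IH]; cbn [app].
  - now rewrite rval_nil, qmul_1l.
  - now rewrite rval_cons, IH, (rval_cons l u), qmul_assoc.
Qed.

Lemma rval_letter_flip l : qmul (rval [l]) (rval [flip l]) = qone.
Proof.
  destruct l as [[] []]; unfold qmul, qone, rval; cbn; f_equal; field.
Qed.

Lemma rval_cancel u l v : rval (u ++ l :: flip l :: v) = rval (u ++ v).
Proof.
  rewrite !rval_app, (rval_cons l), (rval_cons (flip l)), (qmul_assoc (rval [l])),
    rval_letter_flip, qmul_1l. reflexivity.
Qed.

Lemma rval_S3 w : on_S3 (rval w).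
Proof.
  induction w as [|l w IH].
  - rewrite rval_nil. unfold on_S3, qnorm2; cbn; ring.
  - rewrite rval_cons. apply on_S3_mul; [|assumption].
    destruct l as [[] []]; unfold on_S3, qnorm2, rval; cbn; field.
Qed.

Lemma rval_winv w : rval (winv w) = qconj (rval w).
Proof.
  induction w as [|l w IH].
  - unfold winv; cbn. rewrite rval_nil. unfold qconj, qone; cbn. f_equal; ring.
  - change (l :: w) with ([l] ++ w). rewrite winv_app, !rval_app, qconj_mul, IH. f_equal.
    destruct l as [[] []]; unfold qconj, rval, winv; cbn; f_equal; field.
Qed.

(** These are the unit quaternions $a$ for which the pair $(a,a)$ acts trivially on the sphere. *)
Definition scalar_sign (q : quat) : Prop := q = qone \/ q = qscale (-1) qone.

Lemma rval_scalar_sign w : scalar_sign (rval w) ->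
  exists e, zval w = ZQuat (e * 5 ^ Z.of_nat (length w))%Z 0 0 0.
Proof.
  intros H.
  assert (N : 5 ^ length w <> 0) by (apply pow_nonzero; lra).
  assert (P : IZR (5 ^ Z.of_nat (length w)) = 5 ^ length w) by (rewrite <- pow_IZR; reflexivity).
  assert (Q : forall x y : R, x / 5 ^ length w = y -> x = y * 5 ^ length w)
    by (intros x y <-; field; assumption).
  destruct H as [H | H]; [exists 1%Z | exists (-1)%Z];
    unfold rval, qscale, qone in H; cbn [qa qb qc qd] in H;
    injection H as Ha Hb Hc Hd; apply Q in Ha, Hb, Hc, Hd;
    destruct (zval w) as [a b c d]; cbn [za zb zc zd] in *; f_equal; apply eq_IZR;
    rewrite ?mult_IZR, ?P, ?Ha, ?Hb, ?Hc, ?Hd; ring.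
Qed.

(** Freeness is expressed through actions. Cancelling adjacent inverse letters shortens the word
    until it is empty, since a nonempty reduced word never has the value 1 or -1. *)
Theorem quaternions_free (w : fword) : scalar_sign (rval w) ->
  forall (Y : Type) (act : bool * bool -> Y -> Y),
    (forall l y, act l (act (flip l) y) = y) -> forall y, acts act w y = y.
Proof.
  remember (length w) as n eqn:Hn. revert w Hn.
  induction n as [n IH] using lt_wf_ind; intros w -> Hw Y act Hact y.
  destruct (reduced_or_cancel w) as [Hr | (u & l & v & ->)].
  - destruct w as [|l w]; [reflexivity|].
    destruct (rval_scalar_sign _ Hw) as [e He].
    exfalso. refine (reduced_not_scalar _ e _ Hr He). discriminate.
  - rewrite rval_cancel in Hw.
    rewrite acts_app. cbn [acts fold_right]. fold (acts act v y). rewrite Hact, <- acts_app.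
    refine (IH (length (u ++ v)) _ _ eq_refl Hw Y act Hact y).
    rewrite !length_app; cbn; lia.
Qed.

End RealQuaternions.

(* Conjugating u by powers of v turns the free group of rank two into one on infinitely many letters. *)
Definition expand_letter (l : nat * bool) : fword :=
  repeat (false, false) (fst l) ++ [(true, snd l)] ++ repeat (false, true) (fst l).

Definition expand (w : word) : fword := flat_map expand_letter w.

Definition val (w : word) : quat := rval (expand w).

Lemma expand_app u v : expand (u ++ v) = expand u ++ expand v.
Proof. apply flat_map_app. Qed.

Lemma val_app u v : val (u ++ v) = qmul (val u) (val v).
Proof. unfold val. now rewrite expand_app, rval_app. Qed.

Lemma val_nil : val [] = qone.
Proof. apply rval_nil. Qed.

Lemma val_S3 w : on_S3 (val w).
Proof. apply rval_S3. Qed.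

Lemma expand_winv w : expand (winv w) = winv (expand w).
Proof.
  induction w as [|l w IH]; [reflexivity|].
  change (l :: w) with ([l] ++ w). rewrite winv_app, !expand_app, winv_app, IH. f_equal.
  unfold winv, expand, expand_letter; cbn. rewrite !app_nil_r, map_app, rev_app_distr; cbn.
  rewrite !map_repeat, !rev_repeat, <- app_assoc. reflexivity.
Qed.

Lemma val_winv w : val (winv w) = qconj (val w).
Proof. unfold val. now rewrite expand_winv, rval_winv. Qed.

Theorem letters_free (w : word) : scalar_sign (val w) ->
  forall (Y : Type) (act : nat * bool -> Y -> Y),
    (forall l y, act l (act (flip l) y) = y) -> forall y, acts act w y = y.
Proof.
  intros Hw Y act Hact y.
  (* v moves between levels and u acts on level i as the letter i. *)
  pose (act2 := fun (l : bool * bool) (s : Z * Y) =>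
    if fst l then (fst s, act (Z.to_nat (fst s), snd l) (snd s))
    else ((fst s + if snd l then 1 else -1)%Z, snd s)).
  assert (Hact2 : forall l s, act2 l (act2 (flip l) s) = s).
  { intros [[] b] [k y']; unfold act2, flip; cbn.
    - f_equal. apply (Hact (Z.to_nat k, b)).
    - f_equal. destruct b; cbn; lia. }
  assert (Up : forall n (b : bool) k y', acts act2 (repeat (false, b) n) (k, y')
                = ((k + (if b then 1 else -1) * Z.of_nat n)%Z, y')).
  { induction n as [|n IH]; intros b k y'; cbn [repeat acts fold_right].
    - f_equal; lia.
    - change (fold_right act2 (k, y') (repeat (false, b) n)) with (acts act2 (repeat (false, b) n) (k, y')).
      rewrite IH. unfold act2; cbn [fst snd]. f_equal; lia. }
  assert (E : forall y', acts act2 (expand w) (0%Z, y') = (0%Z, acts act w y')).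
  { clear Hw. induction w as [|[i b] w IH]; intros y'; [reflexivity|].
    change ((i, b) :: w) with ([(i, b)] ++ w). rewrite expand_app, !acts_app, IH.
    generalize (acts act w y'); intros y''.
    unfold expand, expand_letter; cbn [flat_map fst snd]. rewrite app_nil_r, !acts_app, Up.
    cbn [acts fold_right]. unfold act2 at 2; cbn [fst snd].
    rewrite Up. f_equal; [lia|]. f_equal. f_equal. lia. }
  specialize (E y). rewrite (quaternions_free _ Hw _ act2 Hact2) in E. congruence.
Qed.

(** * Semigroups of pairs of words *)

Definition wpair := (word * word)%type.

Definition fquat (w : fword) : qquat :=
  let q := zval w in let n := Z.to_pos (5 ^ Z.of_nat (length w)) in
  QQuat (za q # n) (zb q # n) (zc q # n) (zd q # n).

Lemma fquat_rval w : qquat_to_quat (fquat w) = rval w.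
Proof.
  unfold fquat, qquat_to_quat, rval, Q2R, Rdiv; cbn [ra rb rc rd Qnum Qden].
  rewrite Z2Pos.id by (apply Z.pow_pos_nonneg; lia).
  now rewrite <- pow_IZR.
Qed.

Definition pair_quat (g : wpair) : quat * quat := (val (fst g), val (snd g)).

Definition pair_instance (G : list wpair) : instance :=
  map (fun g => (fquat (expand (fst g)), fquat (expand (snd g)))) G.

Lemma pair_instance_gens G : instance_gens (pair_instance G) = map pair_quat G.
Proof.
  unfold instance_gens, pair_instance. rewrite map_map. apply map_ext. intros g; cbn.
  now rewrite !fquat_rval.
Qed.

Lemma pair_instance_valid G : valid_instance (pair_instance G).
Proof.
  apply Forall_map, Forall_forall. intros g _; cbn. rewrite !fquat_rval.
  split; apply rval_S3.
Qed.

Definition left_word (W : list wpair) : word := flat_map fst W.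
Definition right_word (W : list wpair) : word := flat_map snd W.

Lemma left_word_app U V : left_word (U ++ V) = left_word U ++ left_word V.
Proof. apply flat_map_app. Qed.

Lemma right_word_app U V : right_word (U ++ V) = right_word U ++ right_word V.
Proof. apply flat_map_app. Qed.

Lemma word_map_pairs W x : word_map (map pair_quat W) x
  = qmul (qmul (val (left_word W)) x) (qconj (val (right_word W))).
Proof.
  induction W as [|g W IH].
  - cbn. rewrite val_nil, qmul_1l.
    replace (qconj qone) with qone by (unfold qconj, qone; cbn; f_equal; ring).
    now rewrite qmul_1r.
  - cbn [map word_map]. rewrite IH. unfold rot, pair_quat; cbn [fst snd].
    rewrite qinv_unit by apply val_S3.
    unfold left_word, right_word; cbn [flat_map]. rewrite !val_app, qconj_mul, !qmul_assoc.
    reflexivity.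
Qed.

Lemma word_map_app U V x : word_map (U ++ V) x = word_map U (word_map V x).
Proof. induction U as [|g U IH]; cbn; congruence. Qed.

Lemma word_map_S3 W x : on_S3 x -> on_S3 (word_map (map pair_quat W) x).
Proof.
  intros H. rewrite word_map_pairs. repeat apply on_S3_mul; [apply val_S3|assumption|].
  rewrite <- val_winv. apply val_S3.
Qed.

Lemma incl_map_inv {A B} (f : A -> B) (l : list A) (w : list B) :
  incl w (map f l) -> exists u, incl u l /\ w = map f u.
Proof.
  induction w as [|b w IH]; intros H.
  - exists []. split; [apply incl_nil_l | reflexivity].
  - destruct (IH (fun c Hc => H c (or_intror Hc))) as (u & Hu & ->).
    destruct (proj1 (in_map_iff f l b) (H b (or_introl eq_refl))) as (a & <- & Ha).
    exists (a :: u). split; [apply incl_cons; assumption | reflexivity].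
Qed.

Lemma in_semigroup_pairs G f : in_semigroup (map pair_quat G) f <->
  exists W, W <> [] /\ incl W G /\ forall x, on_S3 x -> f x = word_map (map pair_quat W) x.
Proof.
  split.
  - intros (w & Hn & Hi & Hf). destruct (incl_map_inv _ _ _ Hi) as (W & HW & ->).
    exists W. repeat split; try assumption. intros ->; apply Hn; reflexivity.
  - intros (W & Hn & Hi & Hf). exists (map pair_quat W). repeat split.
    + destruct W; [congruence|discriminate].
    + apply incl_map; assumption.
    + assumption.
Qed.

(* Evaluating a q = q b at 1 gives a = b, which is then central. *)
Lemma identity_rotation a b : on_S3 a -> on_S3 b ->
  (forall x, on_S3 x -> qmul (qmul a x) (qconj b) = x) -> a = b /\ scalar_sign a.
Proof.
  intros Ha Hb H.
  assert (H' : forall x, on_S3 x -> qmul a x = qmul x b).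
  { intros x Hx. rewrite <- (H x Hx) at 2.
    assert (Hc : qmul (qconj b) b = qone).
    { unfold on_S3, qnorm2 in Hb. unfold qmul, qconj, qone; cbn; f_equal; try ring. rewrite <- Hb; ring. }
    now rewrite <- qmul_assoc, Hc, qmul_1r. }
  assert (E : a = b).
  { rewrite <- (qmul_1r a), <- (qmul_1l b). apply H'. unfold on_S3, qnorm2, qone; cbn; ring. }
  split; [exact E|]. subst b.
  assert (Hi := H' (Quat 0 1 0 0) ltac:(unfold on_S3, qnorm2; cbn; ring)).
  assert (Hj := H' (Quat 0 0 1 0) ltac:(unfold on_S3, qnorm2; cbn; ring)).
  destruct a as [a b c d]. unfold qmul in Hi, Hj; cbn in Hi, Hj.
  injection Hi as _ _ Hd Hc. injection Hj as _ Hd' _ Hb'.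
  assert (b = 0 /\ c = 0 /\ d = 0)%R as (-> & -> & ->) by (repeat split; lra).
  unfold on_S3, qnorm2 in Ha; cbn in Ha.
  assert (Hs : ((a - 1) * (a + 1) = 0)%R) by lra.
  unfold scalar_sign, qscale, qone; cbn.
  apply Rmult_integral in Hs as [Hs | Hs]; [left | right]; f_equal; lra.
Qed.

(* In such a model every other generator has the same effect through its two words, whereas tau pushes the last coordinate of its first word strictly upwards; so no product involving tau is trivial. *)
Theorem model_not_group (G : list wpair) (w : word) (X : Type)
    (s : nat * bool -> X -> X) (f : nat * bool -> X -> Z) (delta : X -> Z) (p0 : X) :
  (forall l p, s l (s (flip l) p) = p) ->
  (forall l p, f l (s (flip l) p) = - f (flip l) p)%Z ->
  let act l (y : X * Z) := (s l (fst y), (snd y + f l (fst y))%Z) in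
  In (w, []) G ->
  (forall g, In g G -> g = (w, []) \/ forall y, acts act (fst g) y = acts act (snd g) y) ->
  (forall p e, acts act w (p, e) = (p, e + delta p)%Z) ->
  (forall p, 0 <= delta p)%Z -> (0 < delta p0)%Z ->
  ~ semigroup_is_group (instance_gens (pair_instance G)).
Proof.
  intros Hs Hf act Hw HG Hd Hpos H0 [_ Hinv]. rewrite pair_instance_gens in Hinv.
  assert (Hact : forall l y, act l (act (flip l) y) = y).
  { intros l [p e]; unfold act; cbn. rewrite Hs, Hf. f_equal. lia. }
  (* The integer coordinate is only translated and never read, so an initial offset persists. *)
  assert (Hshift : forall u p e k, acts act u (p, e + k)%Z
     = (fst (acts act u (p, e)), snd (acts act u (p, e)) + k)%Z).
  { induction u as [|l u IH]; intros p e k; [reflexivity|].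
    cbn [acts fold_right]. fold (acts act u (p, e + k)%Z). fold (acts act u (p, e)).
    rewrite IH. unfold act; cbn. f_equal. lia. }
  (* An inverse of the rotation of [(w, [])] gives a product that ends in this pair and acts as the
     identity. *)
  destruct (Hinv (fun x => word_map (map pair_quat [(w, [])]) x)) as (g & Hg & Hid).
  { apply in_semigroup_pairs. exists [(w, [])]. repeat split.
    - discriminate.
    - intros a [<- | []]; assumption. }
  apply in_semigroup_pairs in Hg as (W & Wn & Wi & Wg).
  assert (HW : forall x, on_S3 x -> qmul (qmul (val (left_word (W ++ [(w, [])]))) x)
                 (qconj (val (right_word (W ++ [(w, [])])))) = x).
  { intros x Hx. rewrite <- word_map_pairs, map_app, word_map_app, <- Wg.
    - apply Hid; assumption.
    - apply word_map_S3; assumption. }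
  destruct (identity_rotation _ _ (val_S3 _) (val_S3 _) HW) as [E Hsgn].
  assert (T1 := letters_free _ Hsgn _ act Hact (p0, 0%Z)).
  rewrite E in Hsgn. assert (T2 := letters_free _ Hsgn _ act Hact (p0, 0%Z)).
  rewrite left_word_app, acts_app in T1. rewrite right_word_app, acts_app in T2.
  cbn [left_word right_word flat_map app fst snd] in T1, T2. rewrite app_nil_r, Hd in T1.
  cbn [acts fold_right] in T2.
  assert (Hcmp : forall p e, fst (acts act (left_word W) (p, e)) = fst (acts act (right_word W) (p, e))
     /\ (snd (acts act (right_word W) (p, e)) <= snd (acts act (left_word W) (p, e)))%Z).
  { clear - Wi HG Hshift Hd Hpos.
    induction W as [|g W IH]; intros p e; [cbn; split; [reflexivity|lia]|].
    destruct (IH (fun a Ha => Wi a (or_intror Ha)) p e) as [I1 I2].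
    unfold left_word, right_word in *; cbn [flat_map]. rewrite !acts_app.
    destruct (acts act (flat_map fst W) (p, e)) as [p1 e1],
      (acts act (flat_map snd W) (p, e)) as [p2 e2].
    cbn in I1, I2; subst p2.
    destruct g as [u v]; cbn [fst snd].
    destruct (HG (u, v) (Wi (u, v) (or_introl eq_refl))) as [[= -> ->] | Hg]; cbn [fst snd] in *.
    - rewrite Hd; cbn. split; [reflexivity|]. specialize (Hpos p1). lia.
    - rewrite Hg. replace e1 with (e2 + (e1 - e2))%Z by lia. rewrite Hshift; cbn [fst snd].
      split; [reflexivity|]. lia. }
  (* Started at height 0, the left word of [W] ends at minus [delta p0] by [T1], and the right word
     ends at 0 by [T2]; this contradicts the comparison. *)
  destruct (Hcmp p0 0%Z) as [_ H2].
  rewrite Hshift in T1. unfold left_word, right_word in *.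
  rewrite T2 in H2. injection T1 as _ T1. cbn in H2. lia.
Qed.

(** Inverse words are required only up to [val], which determines the rotation. A product is
    inverted by inverting its factors in reverse order. *)
Lemma group_of_inverses (G : list wpair) :
  G <> [] ->
  (forall g, In g G -> exists W, incl W G /\
     val (left_word W) = val (winv (fst g)) /\ val (right_word W) = val (winv (snd g))) ->
  semigroup_is_group (instance_gens (pair_instance G)).
Proof.
  intros Gn Hinv. rewrite pair_instance_gens.
  assert (Hall : forall U, incl U G -> exists W, incl W G /\
     val (left_word W) = val (winv (left_word U)) /\ val (right_word W) = val (winv (right_word U))).
  { induction U as [|g U IH]; intros HU.
    - exists []. repeat split. apply incl_nil_l.
    - destruct (Hinv g (HU g (or_introl eq_refl))) as (W & W1 & W3 & W4).
      destruct IH as (V & V1 & V3 & V4); [intros a Ha; apply HU; right; exact Ha|].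
      exists (V ++ W). repeat split.
      + apply incl_app; assumption.
      + rewrite left_word_app, val_app, V3, W3, <- val_app, <- winv_app. reflexivity.
      + rewrite right_word_app, val_app, V4, W4, <- val_app, <- winv_app. reflexivity. }
  assert (Hrot : forall U W x, val (left_word W) = val (winv (left_word U)) ->
     val (right_word W) = val (winv (right_word U)) ->
     word_map (map pair_quat U) (word_map (map pair_quat W) x) = x /\
     word_map (map pair_quat W) (word_map (map pair_quat U) x) = x).
  { intros U W x E1 E2. rewrite !word_map_pairs, E1, E2, !val_winv.
    assert (HU := val_S3 (left_word U)). assert (HW := val_S3 (right_word U)).
    generalize dependent (val (left_word U)). generalize dependent (val (right_word U)).
    clear. intros b Hb a Ha.
    assert (C : forall c, qconj (qconj c) = c) by (intros []; unfold qconj; cbn; f_equal; ring).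
    assert (Sc : forall c, on_S3 c -> on_S3 (qconj c))
      by (intros c Hc; unfold on_S3, qnorm2, qconj in *; cbn; rewrite <- Hc; ring).
    split.
    - rewrite !qmul_assoc, (qmul_conj_r a Ha), qmul_1l, C, <- qmul_assoc, (qmul_conj_r b Hb), qmul_1r. reflexivity.
    - rewrite C, !qmul_assoc. rewrite <- (C a) at 2. rewrite (qmul_conj_r (qconj a)) by auto.
      rewrite qmul_1l, <- qmul_assoc. rewrite <- (C b) at 2. rewrite (qmul_conj_r (qconj b)) by auto.
      apply qmul_1r. }
  split.
  - destruct G as [|g G]; [congruence|].
    destruct (Hall [g]) as (W & W1 & W3 & W4); [intros a [<-|[]]; left; reflexivity|].
    exists (word_map (map pair_quat ([g] ++ W))). split.
    + apply in_semigroup_pairs. exists ([g] ++ W). repeat split; [discriminate|].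
      apply incl_app; [intros a [<-|[]]; left; reflexivity|assumption].
    + intros x _. rewrite map_app, word_map_app. apply (Hrot [g] W); assumption.
  - intros f Hf. apply in_semigroup_pairs in Hf as (U & U1 & U2 & U3).
    destruct (Hall U U2) as (W & W1 & W3 & W4).
    (* W may be empty, but W U W is not and inverts U as well *)
    exists (word_map (map pair_quat (W ++ U ++ W))). split.
    + apply in_semigroup_pairs. exists (W ++ U ++ W). repeat split.
      * intros E. apply app_eq_nil in E as [_ E]. apply app_eq_nil in E. tauto.
      * repeat apply incl_app; assumption.
    + intros x Hx. rewrite (U3 x Hx), (U3 _ (word_map_S3 (W ++ U ++ W) x Hx)).
      rewrite !map_app, !word_map_app.
      assert (R1 := fun y => proj1 (Hrot U W y W3 W4)).
      assert (R2 := fun y => proj2 (Hrot U W y W3 W4)).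
      split; [rewrite !R2 | rewrite !R1]; reflexivity.
Qed.

(** * Groups presented by relations between words *)

Inductive pres_eq (rels : list wpair) : word -> word -> Prop :=
| pres_refl u : pres_eq rels u u
| pres_sym u v : pres_eq rels u v -> pres_eq rels v u
| pres_trans u v w : pres_eq rels u v -> pres_eq rels v w -> pres_eq rels u w
| pres_app u u' v v' : pres_eq rels u u' -> pres_eq rels v v' -> pres_eq rels (u ++ v) (u' ++ v')
| pres_cancel l : pres_eq rels [l; flip l] []
| pres_rel u v : In (u, v) rels -> pres_eq rels u v.

Lemma pres_winv_r rels u : pres_eq rels (u ++ winv u) [].
Proof.
  induction u as [|l u IH]; [apply pres_refl|].
  change (l :: u) with ([l] ++ u). rewrite winv_app, <- app_assoc.
  eapply pres_trans; [|apply (pres_cancel rels l)].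
  apply (pres_app _ [l] [l]); [apply pres_refl|].
  rewrite app_assoc. apply (pres_app _ _ [] [flip l]); [assumption|apply pres_refl].
Qed.

Lemma pres_winv_l rels u : pres_eq rels (winv u ++ u) [].
Proof. rewrite <- (winv_winv u) at 2. apply pres_winv_r. Qed.

Definition both_signs (gs : list wpair) : list wpair :=
  flat_map (fun g => [g; (winv (fst g), winv (snd g))]) gs.

Definition diagonal (N : nat) : list wpair := map (fun i => ([(i, true)], [(i, true)])) (seq 0 N).

(** All pairs except the last come with their inverses, so only [(w, [])] can fail to be
    invertible. *)
Definition mihailova_gens (N : nat) (rels : list wpair) (w : word) : list wpair :=
  both_signs rels ++ both_signs (diagonal N) ++ [(w, [])].

Definition letters_below (N : nat) (w : word) : Prop := Forall (fun l => fst l < N) w.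

Lemma in_both_signs gs g : In g (both_signs gs) -> In (winv (fst g), winv (snd g)) (both_signs gs).
Proof.
  unfold both_signs. rewrite !in_flat_map. intros (h & Hh & Hg). exists h. split; [assumption|].
  destruct h as [a b]. destruct Hg as [<- | [<- | []]]; cbn [fst snd]; rewrite ?winv_winv; [right; left|left]; reflexivity.
Qed.

Section Presentation.
Variables (N : nat) (rels : list wpair) (w : word).
Hypothesis rels_below : forall g, In g rels -> letters_below N (fst g) /\ letters_below N (snd g).
Let G := mihailova_gens N rels w.

(** A derivation may pass through letters without a diagonal generator. The relations do not contain
    them, so deleting them throughout leaves a derivation in the letters below [N]. *)
Definition clip : word -> word := filter (fun l => fst l <? N).

Lemma clip_below u : letters_below N u -> clip u = u.
Proof.
  induction 1 as [|l u Hl Hu IH]; [reflexivity|].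
  unfold clip in *. cbn [filter]. apply Nat.ltb_lt in Hl. rewrite Hl, IH. reflexivity.
Qed.

Definition linked (u v : word) : Prop := exists W, incl W G /\
  val (left_word W) = val u /\ val (right_word W) = val v.

Lemma linked_app u u' v v' : linked u u' -> linked v v' -> linked (u ++ v) (u' ++ v').
Proof.
  intros (U & U1 & U2 & U3) (V & V1 & V2 & V3). exists (U ++ V). repeat split.
  - apply incl_app; assumption.
  - rewrite left_word_app, !val_app. congruence.
  - rewrite right_word_app, !val_app. congruence.
Qed.

Lemma linked_gen g : In g G -> linked (fst g) (snd g).
Proof.
  intros H. exists [g]. repeat split.
  - intros a [<-|[]]; assumption.
  - cbn. now rewrite app_nil_r.
  - cbn. now rewrite app_nil_r.
Qed.

Lemma linked_val u u' v v' : val u = val u' -> val v = val v' -> linked u v -> linked u' v'.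
Proof. intros E E' (W & W1 & W2 & W3). exists W. split; [assumption|split; congruence]. Qed.

Lemma linked_refl u : linked (clip u) (clip u).
Proof.
  induction u as [|[i b] u IH].
  - exists []. repeat split. apply incl_nil_l.
  - unfold clip in *. cbn [filter fst]. destruct (Nat.ltb_spec i N) as [Hi|Hi]; [|exact IH].
    change ((i, b) :: filter ?f u) with ([(i, b)] ++ filter f u). apply linked_app; [|assumption].
    apply (linked_gen ([(i, b)], [(i, b)])).
    unfold G, mihailova_gens. rewrite !in_app_iff. right; left.
    unfold both_signs, diagonal. apply in_flat_map. exists ([(i, true)], [(i, true)]). split.
    + apply in_map_iff. exists i. split; [reflexivity|]. apply in_seq. lia.
    + destruct b; cbn; auto.
Qed.

Lemma val_cancel_r u : val (u ++ winv u) = qone.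
Proof. rewrite val_app, val_winv. apply qmul_conj_r, val_S3. Qed.

Lemma val_cancel_l u : val (winv u ++ u) = qone.
Proof. rewrite <- (winv_winv u) at 2. apply val_cancel_r. Qed.

Lemma winv_clip u : winv (clip u) = clip (winv u).
Proof.
  unfold clip. induction u as [|l u IH]; [reflexivity|].
  change (l :: u) with ([l] ++ u). rewrite filter_app, !winv_app, filter_app, IH. f_equal.
  destruct l as [i b]; cbn [winv map flip rev app filter fst]. destruct (i <? N); reflexivity.
Qed.

Lemma pres_eq_linked u v : pres_eq rels u v -> linked (clip u) (clip v) /\ linked (clip v) (clip u).
Proof.
  (* The product $(b,b)(a^{-1},b^{-1})(a,a)$ equals $(b,a)$. *)
  assert (Hflip : forall u v, linked (clip u) (clip v) -> linked (winv (clip u)) (winv (clip v)) ->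
    linked (clip v) (clip u)).
  { intros a b Hab Hinv.
    apply (linked_val (clip b ++ winv (clip a) ++ clip a) _ (clip b ++ winv (clip b) ++ clip a) _).
    - rewrite val_app, val_cancel_l. apply qmul_1r.
    - rewrite app_assoc, val_app, val_cancel_r. apply qmul_1l.
    - auto using linked_app, linked_refl. }
  induction 1 as [u|u v _ IH|u v z _ [IH1 IH1'] _ [IH2 IH2']|u u' v v' _ [IH1 IH1'] _ [IH2 IH2']|l|u v Hr].
  - split; apply linked_refl.
  - tauto.
  (* The product $(a,b)(b^{-1},b^{-1})(b,c)$ equals $(a,c)$. *)
  - assert (T : forall a b c, linked (clip a) (clip b) -> linked (clip b) (clip c) -> linked (clip a) (clip c)).
    { intros a b c H1 H2.
      apply (linked_val (clip a ++ winv (clip b) ++ clip b) _ (clip b ++ winv (clip b) ++ clip c) _).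
      - rewrite val_app, val_cancel_l. apply qmul_1r.
      - rewrite app_assoc, val_app, val_cancel_r. apply qmul_1l.
      - apply linked_app; [assumption|]. apply linked_app; [|assumption].
        rewrite winv_clip. apply linked_refl. }
    split; eauto.
  - unfold clip in *; rewrite !filter_app. split; apply linked_app; assumption.
  - assert (E : val (clip [l; flip l]) = val []).
    { destruct l as [i b]; unfold clip; cbn [flip filter fst snd]. destruct (i <? N); [|reflexivity].
      rewrite val_nil. apply (val_cancel_r [(i, b)]). }
    split; apply (linked_val (clip []) _ (clip []) _);
      try exact (linked_refl []); try (symmetry; exact E); reflexivity.
  - destruct (rels_below _ Hr) as [B1 B2]; cbn in B1, B2.
    assert (Hb : In (u, v) (both_signs rels)).
    { unfold both_signs. apply in_flat_map. exists (u, v). cbn; auto. }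
    assert (L1 : linked (clip u) (clip v)).
    { rewrite !clip_below by assumption. apply (linked_gen (u, v)).
      unfold G, mihailova_gens. rewrite in_app_iff. auto. }
    split; [exact L1|]. apply Hflip; [exact L1|]. rewrite !clip_below by assumption.
    apply (linked_gen (winv u, winv v)). apply in_both_signs in Hb.
    unfold G, mihailova_gens. rewrite in_app_iff. auto.
Qed.

(** If $w=1$ in the presented group then also $w^{-1}=1$, so the pair $(w^{-1},1)$ is a product of
    generators. *)
Theorem trivial_word_group : letters_below N w -> rels <> [] -> pres_eq rels w [] ->
  semigroup_is_group (instance_gens (pair_instance G)).
Proof.
  intros Hw Hr Htriv.
  apply group_of_inverses.
  { unfold G, mihailova_gens. destruct rels; [congruence|discriminate]. }
  assert (Hsingle : forall g, In (winv (fst g), winv (snd g)) G -> exists W, incl W G /\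
     val (left_word W) = val (winv (fst g)) /\ val (right_word W) = val (winv (snd g))).
  { intros g Hg. exists [(winv (fst g), winv (snd g))]. repeat split.
    - intros a [<-|[]]; assumption.
    - cbn. now rewrite app_nil_r.
    - cbn. now rewrite app_nil_r. }
  intros g Hg. unfold G, mihailova_gens in Hg. rewrite !in_app_iff in Hg.
  destruct Hg as [Hg | [Hg | [<- | []]]].
  - apply Hsingle. apply in_both_signs in Hg. unfold G, mihailova_gens. rewrite !in_app_iff. auto.
  - apply Hsingle. apply in_both_signs in Hg. unfold G, mihailova_gens. rewrite !in_app_iff. auto.
  - assert (Hi : pres_eq rels (winv w) []).
    { eapply pres_trans; [|apply (pres_winv_l rels w)].
      rewrite <- (app_nil_r (winv w)) at 1. apply pres_app; [apply pres_refl|apply pres_sym, Htriv]. }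
    destruct (pres_eq_linked _ _ Hi) as [(W & W1 & W2 & W3) _].
    rewrite <- winv_clip, (clip_below w Hw) in W2. exists W. repeat split; assumption.
Qed.

End Presentation.

(** * A group simulating progression rules *)

(* The rule rewrites rm * j + rr into rm' * j + rr'. *)
Record rule := Rule { rm : nat; rr : nat; rm' : nat; rr' : nat }.

(** A default for indices out of range; it satisfies [rule_ok] for every marking, so every index
    receives a bijection in the model. *)
Definition idle_rule : rule := Rule 1 0 1 0.

Definition edge (rules : list rule) (n n' : nat) : Prop :=
  exists ru j, In ru rules /\ n = rm ru * j + rr ru /\ n' = rm' ru * j + rr' ru.

Definition xpow (n : nat) : word := repeat (0, true) n.
Definition conj_t (u : word) : word := u ++ [(1, true)] ++ winv u.
Definition token (n : nat) : word := conj_t (xpow n).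
Definition dl : word := [(2, true)].
Definition yl : word := [(3, true)].

Definition rule_rels (i : nat) (ru : rule) : list wpair :=
  let k := [(4 + i, true)] in
  [(k ++ xpow (rm ru), xpow (rm' ru) ++ k); (k ++ token (rr ru), token (rr' ru) ++ k); (dl ++ k, k ++ dl)].

Definition rules_rels (h : nat) (rules : list rule) : list wpair :=
  (dl ++ token h, token h ++ dl) ::
  flat_map (fun i => rule_rels i (nth i rules idle_rule)) (seq 0 (length rules)).

Definition start_rel (n : nat) : wpair := (xpow n, yl).

(** Written with $y$ so that the word does not depend on $n$. Once [start_rel n] identifies $y$ with
    $x^n$, the inner word is $T_{nL}$. *)
Definition test_word (L : nat) : word :=
  let t := conj_t (repeat (3, true) L) in winv t ++ dl ++ t ++ winv dl.

Definition rules_gens (h L : nat) (rules : list rule) (n : nat) : list wpair :=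
  mihailova_gens (4 + length rules) (start_rel n :: rules_rels h rules) (test_word L).

Section Derivations.
Variable rels : list wpair.
Local Notation "u == v" := (pres_eq rels u v) (at level 70).

#[local] Instance pres_eq_equiv : Equivalence (pres_eq rels).
Proof.
  split; [exact (pres_refl rels) | exact (pres_sym rels) | exact (pres_trans rels)].
Qed.

#[local] Instance pres_app_proper : Proper (pres_eq rels ==> pres_eq rels ==> pres_eq rels) (@app (nat * bool)).
Proof. intros u u' Hu v v' Hv. now apply pres_app. Qed.

#[local] Instance pres_winv_proper : Proper (pres_eq rels ==> pres_eq rels) (@winv nat).
Proof.
  intros u v H.
  transitivity (winv u ++ (v ++ winv v)).
  - rewrite pres_winv_r, app_nil_r. reflexivity.
  - rewrite <- H at 1. rewrite app_assoc, pres_winv_l. reflexivity.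
Qed.

Lemma pres_cancel_l k u v : k ++ u == k ++ v -> u == v.
Proof.
  intros H. rewrite <- (app_nil_l u), <- (app_nil_l v), <- (pres_winv_l rels k), <- !app_assoc, H.
  reflexivity.
Qed.

Lemma pres_swap_inv k u v : k ++ u == v ++ k -> k ++ winv u == winv v ++ k.
Proof.
  intros H. apply (pres_cancel_l v). rewrite !app_assoc, pres_winv_r, <- H, <- app_assoc, pres_winv_r.
  now rewrite app_nil_r.
Qed.

Lemma pres_swap_app k u u' v v' : k ++ u == u' ++ k -> k ++ v == v' ++ k ->
  k ++ u ++ v == (u' ++ v') ++ k.
Proof. intros H H'. now rewrite app_assoc, H, <- app_assoc, H', app_assoc. Qed.

Lemma xpow_add m n : xpow (m + n) = xpow m ++ xpow n.
Proof. apply repeat_app. Qed.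

Lemma token_add m n : token (m + n) = xpow m ++ token n ++ winv (xpow m).
Proof. unfold token, conj_t. rewrite xpow_add, winv_app, <- !app_assoc. reflexivity. Qed.

(** Since $T_{mj+r}=x^{mj}T_rx^{-mj}$, the letter $k$ can be passed through the three factors in
    turn. *)
Lemma rule_token k ru j :
  k ++ xpow (rm ru) == xpow (rm' ru) ++ k -> k ++ token (rr ru) == token (rr' ru) ++ k ->
  k ++ token (rm ru * j + rr ru) == token (rm' ru * j + rr' ru) ++ k.
Proof.
  intros Hx Ht.
  assert (Hj : k ++ xpow (rm ru * j) == xpow (rm' ru * j) ++ k).
  { induction j as [|j IH].
    - rewrite !Nat.mul_0_r. cbn. now rewrite app_nil_r.
    - rewrite !Nat.mul_succ_r, !xpow_add. now apply pres_swap_app. }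
  rewrite !token_add. apply pres_swap_app; [assumption|]. apply pres_swap_app; [assumption|].
  now apply pres_swap_inv.
Qed.

(** Conjugation by $k$ fixes $d$ and carries $T_n$ to $T_{n'}$, so commutation with $d$ is pulled
    back along an edge. *)
Lemma commute_edge k d n n' : k ++ token n == token n' ++ k -> d ++ k == k ++ d ->
  d ++ token n' == token n' ++ d -> d ++ token n == token n ++ d.
Proof.
  intros Ht Hd IH. apply (pres_cancel_l k).
  rewrite app_assoc, <- Hd, <- app_assoc, Ht, app_assoc, IH, <- app_assoc, Hd, app_assoc, <- Ht, <- app_assoc.
  reflexivity.
Qed.

End Derivations.

Lemma commute_path h rules rels n :
  incl (rules_rels h rules) rels -> clos_refl_trans_1n nat (edge rules) n h ->
  pres_eq rels (dl ++ token n) (token n ++ dl).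
Proof.
  intros Hi Hp. remember h as h' eqn:E in Hp. induction Hp as [n|n n' h' (ru & j & Hin & -> & ->) Hp IH]; subst.
  - apply pres_rel, Hi. left; reflexivity.
  - destruct (In_nth _ _ idle_rule Hin) as (i & Hil & Hnth).
    assert (Hr : forall g, In g (rule_rels i ru) -> pres_eq rels (fst g) (snd g)).
    { intros [a b] Hg. apply pres_rel, Hi. right. apply in_flat_map. exists i. split.
      - apply in_seq. lia.
      - now rewrite Hnth. }
    apply (commute_edge _ [(4 + i, true)] dl _ (rm' ru * j + rr' ru)); [|apply (Hr (_, _)); cbn; auto|auto].
    apply rule_token; apply (Hr (_, _)); cbn; auto.
Qed.

Lemma letters_below_app N u v : letters_below N u -> letters_below N v -> letters_below N (u ++ v).
Proof. intros. apply Forall_app; split; assumption. Qed.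

Lemma letters_below_repeat N i b n : i < N -> letters_below N (repeat (i, b) n).
Proof. intros H. apply Forall_forall. intros l Hl. apply repeat_spec in Hl as ->. exact H. Qed.

Lemma letters_below_letter N i b : i < N -> letters_below N [(i, b)].
Proof. intros H. exact (letters_below_repeat N i b 1 H). Qed.

Lemma letters_below_winv N u : letters_below N u -> letters_below N (winv u).
Proof.
  intros H. apply Forall_forall. intros l Hl. unfold winv in Hl. rewrite <- in_rev, in_map_iff in Hl.
  destruct Hl as (l' & <- & Hl). exact (proj1 (Forall_forall _ _) H l' Hl).
Qed.

Ltac solve_below := unfold test_word, token, conj_t, xpow, dl, yl;
  repeat match goal with
  | |- letters_below _ (_ ++ _) => apply letters_below_app
  | |- letters_below _ (winv _) => apply letters_below_winv
  | |- letters_below _ (repeat _ _) => apply letters_below_repeat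
  | |- letters_below _ [_] => apply letters_below_letter
  end; lia.

Theorem rules_group h L rules n :
  clos_refl_trans_1n nat (edge rules) (n * L) h ->
  semigroup_is_group (instance_gens (pair_instance (rules_gens h L rules n))).
Proof.
  intros Hp. set (rels := start_rel n :: rules_rels h rules).
  apply trivial_word_group.
  - intros g [<- | [<- | Hg]]; [cbn [start_rel fst snd]; split; solve_below | cbn [fst snd]; split; solve_below |].
    apply in_flat_map in Hg as (i & Hi & Hg). apply in_seq in Hi.
    destruct Hg as [<- | [<- | [<- | []]]]; cbn [fst snd]; split; solve_below.
  - solve_below.
  - discriminate.
  - fold rels.
    pose proof (pres_eq_equiv rels). pose proof (pres_app_proper rels). pose proof (pres_winv_proper rels).
    assert (Hy : forall l, pres_eq rels (repeat (3, true) l) (xpow (n * l))).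
    { intros l. rewrite Nat.mul_comm. induction l as [|l IH]; cbn [repeat Nat.mul]; [reflexivity|].
      rewrite xpow_add.
      apply (pres_app _ yl (xpow n)); [apply pres_sym, pres_rel; left; reflexivity|].
      apply IH. }
    assert (Ht : pres_eq rels (conj_t (repeat (3, true) L)) (token (n * L))).
    { unfold token, conj_t. now rewrite Hy. }
    assert (Hc : pres_eq rels (dl ++ token (n * L)) (token (n * L) ++ dl)).
    { apply (commute_path h rules); [intros g Hg; right; exact Hg | exact Hp]. }
    unfold test_word. cbv zeta. rewrite Ht, (app_assoc dl), Hc, <- app_assoc, pres_winv_r, app_nil_r.
    apply pres_winv_l.
Qed.

(** * Cantor-Bernstein *)

Section CantorBernstein.
Context {A B : Type} (f : A -> B) (g : B -> A).
Hypothesis f_inj : forall a a', f a = f a' -> a = a'.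
Hypothesis g_inj : forall b b', g b = g b' -> b = b'.

(** The points whose chain of alternating preimages under [g] and [f] stops outside the image of
    [g]. *)
Inductive lost : A -> Prop :=
| lost_start a : (forall b, g b <> a) -> lost a
| lost_step a : lost a -> lost (g (f a)).

(** The values of the bijection are kept explicit so that properties shared by [f] and [g] can be
    transferred to it. *)
Lemma cantor_bernstein : exists (h : A -> B) (k : B -> A),
  (forall a, k (h a) = a) /\ (forall b, h (k b) = b) /\
  forall a, (lost a /\ h a = f a) \/ (~ lost a /\ g (h a) = a).
Proof.
  assert (Hex : forall a, exists b, (lost a /\ b = f a) \/ (~ lost a /\ g b = a)).
  { intros a. destruct (classic (lost a)) as [H|H]; [exists (f a); auto|].
    apply NNPP. intros Hn. apply H, lost_start. intros b Hb. apply Hn. exists b; auto. }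
  pose (h := fun a => proj1_sig (constructive_indefinite_description _ (Hex a))).
  assert (Hh : forall a, (lost a /\ h a = f a) \/ (~ lost a /\ g (h a) = a))
    by (intros a; exact (proj2_sig (constructive_indefinite_description _ (Hex a)))).
  assert (Hinj : forall a a', h a = h a' -> a = a').
  { intros a a' E. destruct (Hh a) as [[H1 H2]|[H1 H2]], (Hh a') as [[H3 H4]|[H3 H4]].
    - apply f_inj. congruence.
    - exfalso. apply H3. rewrite <- H4, <- E, H2. now apply lost_step.
    - exfalso. apply H1. rewrite <- H2, E, H4. now apply lost_step.
    - congruence. }
  assert (Hsur : forall b, exists a, h a = b).
  { intros b. destruct (classic (lost (g b))) as [H|H].
    - inversion H as [a Ha E|a Ha E].
      + exfalso. exact (Ha b eq_refl).
      + apply g_inj in E. exists a. destruct (Hh a) as [[_ H2]|[H1 _]]; [congruence|contradiction].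
    - exists (g b). destruct (Hh (g b)) as [[H1 _]|[_ H2]]; [contradiction|]. now apply g_inj. }
  pose (k := fun b => proj1_sig (constructive_indefinite_description _ (Hsur b))).
  assert (Hk : forall b, h (k b) = b)
    by (intros b; exact (proj2_sig (constructive_indefinite_description _ (Hsur b)))).
  exists h, k. repeat split; auto.
Qed.

End CantorBernstein.

(** * A permutation model *)

Section Model.
Local Open Scope Z_scope.
Variable chi : Z -> bool.

(* Copies of the integers: the root carries the configurations, and a node is a junk copy with its own marking, labelled by where it comes from. *)
Inductive copy := Root | Node (mark : Z -> bool) (s : Z) (c : copy).

Definition marked (b : Z * copy) : bool :=
  match snd b with Root => chi (fst b) | Node mark _ _ => mark (fst b) end.

Definition shift (k : Z) (b : Z * copy) : Z * copy := (fst b + k, snd b).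

(* Sends the progression r + m Z of the root onto r' + m' Z, and every other residue class modulo m of every copy into the class of r' modulo m' of a junk copy whose other elements are unmarked. *)
Definition inject (m r m' r' : Z) (b : Z * copy) : Z * copy :=
  let s := (fst b - r) mod m in let j := (fst b - r) / m in
  let node := Node (fun q => ((q - r') mod m' =? 0) && marked (m * ((q - r') / m') + s + r, snd b)) s (snd b) in
  (m' * j + r', match snd b with Root => if s =? 0 then Root else node | Node _ _ _ => node end).

Section Inject.
Variables m r m' r' : Z.
Hypothesis m_pos : 0 < m.
Hypothesis m'_pos : 0 < m'.

Lemma inject_special j : inject m r m' r' (m * j + r, Root) = (m' * j + r', Root).
Proof.
  unfold inject; cbn [fst snd].
  replace (m * j + r - r) with (j * m) by ring. rewrite Z.mod_mul, Z.div_mul by lia. reflexivity.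
Qed.

Lemma inject_shift k b : inject m r m' r' (shift (m * k) b) = shift (m' * k) (inject m r m' r' b).
Proof.
  unfold inject, shift; cbn [fst snd].
  replace (fst b + m * k - r) with (fst b - r + k * m) by ring.
  rewrite Z.mod_add, Z.div_add by lia. f_equal. ring.
Qed.

(** The new position determines the quotient, and the label of the node records the residue and the
    source copy. Only residue 0 of the root lands in the root. *)
Lemma inject_inj b b' : inject m r m' r' b = inject m r m' r' b' -> b = b'.
Proof.
  destruct b as [i c], b' as [i' c']; unfold inject; cbn [fst snd]. intros H.
  injection H as H1 H2.
  assert (Hj : (i - r) / m = (i' - r) / m) by nia.
  assert (Hi := Z.div_mod (i - r) m ltac:(lia)). assert (Hi' := Z.div_mod (i' - r) m ltac:(lia)).
  assert (Hgoal : (i - r) mod m = (i' - r) mod m /\ c = c' -> (i, c) = (i', c')).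
  { intros [E ->]. f_equal. rewrite Hj, E in Hi. lia. }
  apply Hgoal.
  destruct c as [|mk s c], c' as [|mk' s' c'];
    destruct (Z.eqb_spec ((i - r) mod m) 0) as [E1|E1], (Z.eqb_spec ((i' - r) mod m) 0) as [E2|E2];
    try discriminate H2; try (split; congruence); injection H2; intros; split; congruence.
Qed.

(** A junk copy inherits its marks from its source by construction; the hypothesis on [chi] settles
    the progression of the root. *)
Lemma inject_marked b : (forall j, chi (m * j + r) = chi (m' * j + r')) ->
  marked (inject m r m' r' b) = marked b.
Proof.
  destruct b as [i c]. intros Hchi.
  assert (Hi := Z.div_mod (i - r) m ltac:(lia)).
  assert (Hnode : marked (m' * ((i - r) / m) + r', Node (fun q => ((q - r') mod m' =? 0) &&
      marked (m * ((q - r') / m') + (i - r) mod m + r, c)) ((i - r) mod m) c) = marked (i, c)).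
  { unfold marked at 1; cbn [fst snd].
    replace (m' * ((i - r) / m) + r' - r') with ((i - r) / m * m') by ring.
    rewrite Z.mod_mul, Z.div_mul by lia. cbn [Z.eqb andb]. f_equal. f_equal. lia. }
  unfold inject; cbn [fst snd]. destruct c as [|mk s c]; [|exact Hnode].
  destruct (Z.eqb_spec ((i - r) mod m) 0) as [E|E]; [|exact Hnode].
  unfold marked; cbn [fst snd]. rewrite <- Hchi. f_equal. lia.
Qed.

End Inject.

Lemma shift_shift k l b : shift k (shift l b) = shift (l + k) b.
Proof. unfold shift; cbn. f_equal. ring. Qed.

Lemma shift_0 b : shift 0 b = b.
Proof. destruct b; unfold shift; cbn. f_equal. ring. Qed.

(** Both injections turn translation by a multiple of one modulus into translation by the same
    multiple of the other, so whole chains are translated. *)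
Lemma lost_shift m r m' r' k b : 0 < m -> 0 < m' ->
  lost (inject m r m' r') (inject m' r' m r) b ->
  lost (inject m r m' r') (inject m' r' m r) (shift (m * k) b).
Proof.
  intros Hm Hm'. induction 1 as [b Hb|b Hb IH].
  - apply lost_start. intros a Ha. apply (Hb (shift (m' * - k) a)).
    rewrite inject_shift by assumption. rewrite Ha, shift_shift.
    replace (m * k + m * - k) with 0 by ring. apply shift_0.
  - rewrite <- inject_shift, <- inject_shift by assumption. now apply lost_step.
Qed.

(** Cantor-Bernstein is applied to the two opposite injections. Both preserve marks and intertwine
    the shifts, and the choice between them is invariant under [shift m], so the bijection has the
    same properties. *)
Lemma rule_bijection m r m' r' : 0 < m -> 0 < m' -> (forall j, chi (m * j + r) = chi (m' * j + r')) ->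
  exists h k : Z * copy -> Z * copy,
    (forall b, k (h b) = b) /\ (forall b, h (k b) = b) /\
    h (r, Root) = (r', Root) /\ (forall b, h (shift m b) = shift m' (h b)) /\
    (forall b, marked (h b) = marked b).
Proof.
  intros Hm Hm' Hchi.
  destruct (cantor_bernstein (inject m r m' r') (inject m' r' m r)) as (h & k & Hkh & Hhk & Hh);
    [now apply inject_inj | now apply inject_inj |].
  assert (Sp : inject m' r' m r (r', Root) = (r, Root)).
  { assert (E := inject_special m' r' m r Hm' 0). now rewrite !Z.mul_0_r, !Z.add_0_l in E. }
  assert (Sp' : inject m r m' r' (r, Root) = (r', Root)).
  { assert (E := inject_special m r m' r' Hm 0). now rewrite !Z.mul_0_r, !Z.add_0_l in E. }
  exists h, k. repeat split; try assumption.
  (* The injections are mutually inverse at these two points of the root, so both cases give the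
     same value. *)
  - destruct (Hh (r, Root)) as [[_ ->]|[_ E]]; [exact Sp'|].
    apply (inject_inj m' r' m r Hm' Hm). congruence.
  - intros b. assert (E1 := inject_shift m r m' r' Hm 1 b). rewrite !Z.mul_1_r in E1.
    assert (L : lost (inject m r m' r') (inject m' r' m r) (shift m b) <->
                lost (inject m r m' r') (inject m' r' m r) b).
    { split; intros Hl.
      - apply (lost_shift m r m' r' (-1)) in Hl; try assumption. rewrite shift_shift in Hl.
        replace (m + m * -1) with 0 in Hl by ring. now rewrite shift_0 in Hl.
      - apply (lost_shift m r m' r' 1) in Hl; try assumption. now rewrite Z.mul_1_r in Hl. }
    destruct (Hh b) as [[H1 H2]|[H1 H2]], (Hh (shift m b)) as [[H3 H4]|[H3 H4]]; try tauto.
    + congruence.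
    + apply (inject_inj m' r' m r Hm' Hm). rewrite H4.
      assert (E2 := inject_shift m' r' m r Hm' 1 (h b)). rewrite !Z.mul_1_r in E2. congruence.
  - intros b. destruct (Hh b) as [[_ ->]|[_ E]].
    + now apply inject_marked.
    + rewrite <- E at 2. symmetry. apply inject_marked; auto.
Qed.

End Model.

(** Here [j] runs over all integers, because in the model $x$ translates whole copies of the
    integers. *)
Definition rule_ok (chi : Z -> bool) (ru : rule) : Prop :=
  0 < rm ru /\ 0 < rm' ru /\
  forall j, chi (Z.of_nat (rm ru) * j + Z.of_nat (rr ru))%Z = chi (Z.of_nat (rm' ru) * j + Z.of_nat (rr' ru))%Z.

(** * The permutation model of a system of rules *)

Section Soundness.
Variables (chi : Z -> bool) (rules : list rule) (h L n : nat).
Hypothesis rules_ok : Forall (rule_ok chi) rules.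
Hypothesis chi_h : chi (Z.of_nat h) = false.
Hypothesis chi_start : chi (Z.of_nat (n * L)) = true.

Lemma nth_rule_ok i : rule_ok chi (nth i rules idle_rule).
Proof.
  destruct (Nat.lt_ge_cases i (length rules)) as [H|H].
  - eapply Forall_forall; [exact rules_ok|]. now apply nth_In.
  - rewrite nth_overflow by assumption. repeat split; cbn; auto.
Qed.

Lemma rule_moves : exists (h k : nat -> Z * copy -> Z * copy), forall i,
  let ru := nth i rules idle_rule in
  (forall b, k i (h i b) = b) /\ (forall b, h i (k i b) = b) /\
  h i (Z.of_nat (rr ru), Root) = (Z.of_nat (rr' ru), Root) /\
  (forall b, h i (shift (Z.of_nat (rm ru)) b) = shift (Z.of_nat (rm' ru)) (h i b)) /\
  (forall b, marked chi (h i b) = marked chi b).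
Proof.
  assert (Hi : forall i, let ru := nth i rules idle_rule in exists h k, 
    (forall b, k (h b) = b) /\ (forall b, h (k b) = b) /\
    h (Z.of_nat (rr ru), Root) = (Z.of_nat (rr' ru), Root) /\
    (forall b, h (shift (Z.of_nat (rm ru)) b) = shift (Z.of_nat (rm' ru)) (h b)) /\
    (forall b, marked chi (h b) = marked chi b)).
  { intros i ru. destruct (nth_rule_ok i) as (H1 & H2 & H3).
    apply rule_bijection; [subst ru; lia | subst ru; lia | exact H3]. }
  cbv zeta in Hi.
  pose (hh := fun i => constructive_indefinite_description _ (Hi i)).
  exists (fun i => proj1_sig (hh i)).
  exists (fun i => proj1_sig (constructive_indefinite_description _ (proj2_sig (hh i)))).
  intros i ru. exact (proj2_sig (constructive_indefinite_description _ (proj2_sig (hh i)))).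
Qed.

Definition at_origin (b : Z * copy) : bool :=
  match snd b with Root => Z.eqb (fst b) 0 | Node _ _ _ => false end.

(** A step function of the counter at marked points. It is nondecreasing in the counter, which makes
    the translation by tau nonnegative. *)
Definition weight (p : (Z * copy) * Z) : Z := if marked chi (fst p) && (0 <=? snd p)%Z then 1 else 0.

Definition sgn (b : bool) : Z := if b then 1 else -1.

Section Letters.
Variables hm km : nat -> Z * copy -> Z * copy.

(** The letters 0, 1, 2, 3 and $4+i$ are $x$, $t$, $d$, $y$ and $k_i$. Only $t$ changes the counter,
    and only at the origin of the root; $d$ acts through [climb] alone. *)
Definition move (l : nat * bool) (p : (Z * copy) * Z) : (Z * copy) * Z :=
  match l with
  | (0, b) => (shift (sgn b) (fst p), snd p)
  | (1, b) => (fst p, if at_origin (fst p) then (snd p + sgn b)%Z else snd p)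
  | (2, _) => p
  | (3, b) => (shift (sgn b * Z.of_nat n) (fst p), snd p)
  | (S (S (S (S i))), true) => (hm i (fst p), snd p)
  | (S (S (S (S i))), false) => (km i (fst p), snd p)
  end.

Definition climb (l : nat * bool) (p : (Z * copy) * Z) : Z :=
  match l with (2, b) => sgn b * weight p | _ => 0 end.

Definition mact (l : nat * bool) (y : ((Z * copy) * Z) * Z) :=
  (move l (fst y), (snd y + climb l (fst y))%Z).

Hypothesis moves : forall i,
  let ru := nth i rules idle_rule in
  (forall b, km i (hm i b) = b) /\ (forall b, hm i (km i b) = b) /\
  hm i (Z.of_nat (rr ru), Root) = (Z.of_nat (rr' ru), Root) /\
  (forall b, hm i (shift (Z.of_nat (rm ru)) b) = shift (Z.of_nat (rm' ru)) (hm i b)) /\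
  (forall b, marked chi (hm i b) = marked chi b).

Lemma move_flip l p : move l (move (flip l) p) = p.
Proof.
  destruct p as [b z], l as [[|[|[|[|i]]]] s]; cbn.
  - rewrite shift_shift. replace (sgn (negb s) + sgn s)%Z with 0%Z by (destruct s; reflexivity).
    now rewrite shift_0.
  - f_equal. destruct (at_origin b); [destruct s; cbn; lia|reflexivity].
  - reflexivity.
  - rewrite shift_shift. replace (_ + _)%Z with 0%Z by (destruct s; cbn [negb sgn]; lia).
    now rewrite shift_0.
  - destruct (moves i) as (H1 & H2 & _). destruct s; cbn; f_equal; auto.
Qed.

Lemma climb_flip l p : climb l (move (flip l) p) = (- climb (flip l) p)%Z.
Proof.
  destruct l as [[|[|[|i]]] s]; try reflexivity. cbn [flip fst snd climb move].
  destruct s; cbn [negb sgn]; lia.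
Qed.

Lemma mact_flip l y : mact l (mact (flip l) y) = y.
Proof.
  destruct y as [p e]; unfold mact; cbn [fst snd]. rewrite move_flip, climb_flip. f_equal. lia.
Qed.

Lemma acts_repeat_0 k b z e : acts mact (repeat (0, true) k) (b, z, e) = (shift (Z.of_nat k) b, z, e).
Proof.
  induction k as [|k IH].
  - cbn [repeat acts fold_right Z.of_nat]. now rewrite shift_0.
  - cbn [repeat acts fold_right]. fold (acts mact (repeat (0, true) k) (b, z, e)). rewrite IH.
    unfold mact; cbn [fst snd move climb sgn]. rewrite shift_shift. f_equal; [f_equal; f_equal; lia|lia].
Qed.

Lemma acts_repeat_3 k b z e : acts mact (repeat (3, true) k) (b, z, e) = (shift (Z.of_nat (n * k)) b, z, e).
Proof.
  induction k as [|k IH].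
  - rewrite Nat.mul_0_r. cbn [repeat acts fold_right Z.of_nat]. now rewrite shift_0.
  - cbn [repeat acts fold_right]. fold (acts mact (repeat (3, true) k) (b, z, e)). rewrite IH.
    unfold mact; cbn [fst snd move climb sgn]. rewrite shift_shift. f_equal; [f_equal; f_equal; lia|lia].
Qed.

Definition is_root (k : Z) (b : Z * copy) : bool :=
  match snd b with Root => Z.eqb (fst b) k | Node _ _ _ => false end.

Lemma is_root_spec k b : is_root k b = true <-> b = (k, Root).
Proof.
  destruct b as [i [|mk s c]]; unfold is_root; cbn.
  - rewrite Z.eqb_eq. split; [now intros -> | congruence].
  - split; congruence.
Qed.

(** Conjugating $t$ by a translation moves the only place where it acts from the origin of the root
    to position [k]. *)
Lemma acts_conj_t u k : (forall b z e, acts mact u (b, z, e) = (shift k b, z, e)) ->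
  forall b z e, acts mact (conj_t u) (b, z, e) = (b, if is_root k b then z + 1 else z, e)%Z.
Proof.
  intros Hu b z e. unfold conj_t. rewrite !acts_app.
  assert (Hi : acts mact (winv u) (b, z, e) = (shift (- k) b, z, e)).
  { assert (E := acts_winv_l mact mact_flip u (shift (- k) b, z, e)). rewrite Hu, shift_shift in E.
    replace (- k + k)%Z with 0%Z in E by lia. rewrite shift_0 in E. exact E. }
  assert (Ht : forall b', acts mact [(1, true)] (b', z, e) = (b', if at_origin b' then z + 1 else z, e)%Z).
  { intros b'. unfold acts, mact; cbn [fold_right fst snd move climb sgn]. now rewrite Z.add_0_r. }
  rewrite Hi, Ht, Hu, shift_shift. replace (- k + k)%Z with 0%Z by lia. rewrite shift_0.
  assert (E : at_origin (shift (- k) b) = is_root k b).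
  { destruct b as [i [|mk s c]]; unfold at_origin, is_root, shift; cbn [fst snd]; [|reflexivity].
    apply eq_true_iff_eq. rewrite !Z.eqb_eq. lia. }
  now rewrite E.
Qed.

Lemma acts_token k b z e :
  acts mact (token k) (b, z, e) = (b, if is_root (Z.of_nat k) b then z + 1 else z, e)%Z.
Proof. apply acts_conj_t. intros. apply acts_repeat_0. Qed.

Lemma acts_dl b z e : acts mact dl (b, z, e) = (b, z, e + weight (b, z))%Z.
Proof. unfold dl, acts, mact; cbn [fold_right fst snd move climb sgn]. now rewrite Z.mul_1_l. Qed.

Lemma acts_kl i b z e : acts mact [(4 + i, true)] (b, z, e) = (hm i b, z, e).
Proof. cbn [Nat.add acts fold_right]. unfold mact. cbn [fst snd move climb]. now rewrite Z.add_0_r. Qed.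

Lemma relations_hold g : In g (start_rel n :: rules_rels h rules) ->
  forall y, acts mact (fst g) y = acts mact (snd g) y.
Proof.
  intros Hg [[b z] e]. destruct Hg as [<- | [<- | Hg]]; cbn [fst snd start_rel].
  - unfold xpow. rewrite acts_repeat_0. unfold yl, acts, mact; cbn [fold_right fst snd move climb sgn].
    now rewrite Z.mul_1_l, Z.add_0_r.
  (* $T_h$ changes the counter only at the final code, which is unmarked and so has weight 0
     whatever its counter. *)
  - rewrite !acts_app, acts_dl, !acts_token, acts_dl. f_equal.
    destruct (is_root (Z.of_nat h) b) eqn:E; [|reflexivity].
    apply is_root_spec in E as ->. unfold weight, marked; cbn [fst snd]. now rewrite chi_h.
  - apply in_flat_map in Hg as (i & _ & Hg).
    destruct (moves i) as (H1 & H2 & H3 & H4 & H5).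
    destruct Hg as [<- | [<- | [<- | []]]]; cbn [fst snd]; rewrite !acts_app.
    + unfold xpow. rewrite acts_repeat_0, !acts_kl, acts_repeat_0, H4. reflexivity.
    + rewrite acts_token, !acts_kl, acts_token.
      (* The bijection matches the one place where $T_r$ acts with the one place where $T_{r'}$
         acts. *)
      assert (E : is_root (Z.of_nat (rr (nth i rules idle_rule))) b
                = is_root (Z.of_nat (rr' (nth i rules idle_rule))) (hm i b)).
      { apply eq_true_iff_eq. rewrite !is_root_spec, <- H3. split; [now intros ->|].
        intros E. now rewrite <- (H1 b), E, H1. }
      now rewrite E.
    + rewrite acts_kl, !acts_dl, acts_kl. unfold weight; cbn [fst snd]. now rewrite H5.
Qed.

Lemma generators_hold g : In g (rules_gens h L rules n) ->
  g = (test_word L, []) \/ forall y, acts mact (fst g) y = acts mact (snd g) y.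
Proof.
  intros Hg. unfold rules_gens, mihailova_gens in Hg. rewrite !in_app_iff in Hg.
  assert (Hboth : forall gs, (forall g, In g gs -> forall y, acts mact (fst g) y = acts mact (snd g) y) ->
     forall g, In g (both_signs gs) -> forall y, acts mact (fst g) y = acts mact (snd g) y).
  { intros gs Hgs g' Hg' y. apply in_flat_map in Hg' as (a & Ha & [<- | [<- | []]]); [auto|]. cbn [fst snd].
    rewrite <- (acts_winv_r mact mact_flip (snd a) y) at 1. rewrite <- Hgs by assumption.
    apply acts_winv_l, mact_flip. }
  destruct Hg as [Hg | [Hg | [<- | []]]]; [right | right | left; reflexivity].
  - exact (Hboth _ relations_hold g Hg).
  - refine (Hboth _ _ g Hg). intros a Ha y. apply in_map_iff in Ha as (i & <- & _). reflexivity.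
Qed.

Definition gain (p : (Z * copy) * Z) : Z :=
  weight (fst p, if is_root (Z.of_nat (n * L)) (fst p) then snd p + 1 else snd p)%Z - weight p.

(** Read from the right, $d^{-1}$ subtracts the old weight, $T$ raises the counter at one place, $d$
    adds the new weight, and $T^{-1}$ restores the counter. *)
Lemma acts_test_word p e : acts mact (test_word L) (p, e) = (p, e + gain p)%Z.
Proof.
  destruct p as [b z]. unfold test_word. cbv zeta. rewrite !acts_app.
  assert (Hw : acts mact (winv dl) (b, z, e) = (b, z, e - weight (b, z))%Z).
  { unfold dl, winv, acts, mact; cbn [map rev app flip negb fold_right fst snd move climb sgn].
    f_equal. }
  assert (Ht : forall e', acts mact (conj_t (repeat (3, true) L)) (b, z, e')
     = (b, if is_root (Z.of_nat (n * L)) b then z + 1 else z, e')%Z).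
  { intros e'. apply acts_conj_t. intros. apply acts_repeat_3. }
  rewrite Hw, Ht, acts_dl. unfold gain; cbn [fst snd].
  set (z' := if is_root _ _ then _ else _).
  replace (e - weight (b, z) + weight (b, z'))%Z with (e + (weight (b, z') - weight (b, z)))%Z by lia.
  subst z'. rewrite <- Ht. apply acts_winv_l, mact_flip.
Qed.

End Letters.

Theorem rules_not_group :
  ~ semigroup_is_group (instance_gens (pair_instance (rules_gens h L rules n))).
Proof.
  destruct rule_moves as (hm & km & Hm).
  (* At counter -1 the increment crosses the threshold of [weight], so the gain there is 1. *)
  apply (model_not_group _ (test_word L) _ (move hm km) climb gain ((Z.of_nat (n * L), Root), (-1)%Z)).
  - apply move_flip, Hm.
  - apply climb_flip.
  - unfold rules_gens, mihailova_gens. rewrite !in_app_iff. cbn; auto.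
  - exact (generators_hold hm km Hm).
  - exact (acts_test_word hm km Hm).
  - intros [b z]. unfold gain, weight; cbn [fst snd].
    destruct (marked chi b), (is_root (Z.of_nat (n * L)) b); cbn [andb]; try lia.
    destruct (Z.leb_spec 0 z), (Z.leb_spec 0 (z + 1)); lia.
  - unfold gain, weight; cbn [fst snd].
    rewrite (proj2 (is_root_spec _ _) eq_refl). unfold marked; cbn [fst snd]. now rewrite chi_start.
Qed.

End Soundness.

(** * Counter machines as progression rules *)

(* Sylvester's sequence: pairwise coprime by construction. *)
Fixpoint sylvester_prod (i : nat) : nat :=
  match i with O => 1 | S i => sylvester_prod i * S (sylvester_prod i) end.

Definition sylvester (i : nat) : nat := S (sylvester_prod i).

Definition bezout (a b : nat) : Prop := exists u v : Z, (u * Z.of_nat a + v * Z.of_nat b = 1)%Z.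

Lemma bezout_sym a b : bezout a b -> bezout b a.
Proof. intros (u & v & H). exists v, u. lia. Qed.

Lemma bezout_mul a b c : bezout a b -> bezout a c -> bezout a (b * c).
Proof.
  intros (u & v & H) (u' & v' & H').
  exists (u * u' * Z.of_nat a + u * v' * Z.of_nat c + v * Z.of_nat b * u')%Z, (v * v')%Z.
  rewrite Nat2Z.inj_mul.
  transitivity ((u * Z.of_nat a + v * Z.of_nat b) * (u' * Z.of_nat a + v' * Z.of_nat c))%Z; [ring|].
  now rewrite H, H'.
Qed.

Lemma bezout_pow a b n : bezout a b -> bezout a (b ^ n).
Proof.
  intros H. induction n as [|n IH]; [exists 0%Z, 1%Z; reflexivity|].
  cbn [Nat.pow]. now apply bezout_mul.
Qed.

Lemma sylvester_prod_pos i : 0 < sylvester_prod i.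
Proof. induction i; cbn; nia. Qed.

Lemma sylvester_divide i j : i < j -> Nat.divide (sylvester i) (sylvester_prod j).
Proof.
  induction 1 as [|j _ IH]; cbn [sylvester_prod].
  - exists (sylvester_prod i). reflexivity.
  - now apply Nat.divide_mul_l.
Qed.

Lemma sylvester_bezout i j : i <> j -> bezout (sylvester i) (sylvester j).
Proof.
  assert (H : forall i j, i < j -> bezout (sylvester i) (sylvester j)).
  { clear. intros i j H. destruct (sylvester_divide i j H) as [q Hq].
    exists (- Z.of_nat q)%Z, 1%Z. unfold sylvester at 2. rewrite Hq. lia. }
  intros Hij. destruct (Nat.lt_ge_cases i j); [auto|apply bezout_sym, H; lia].
Qed.

Fixpoint godel (k : nat) (f : nat -> nat) : nat :=
  match k with O => 1 | S k => godel k f * sylvester k ^ f k end.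

Lemma godel_ext k f f' : (forall r, r < k -> f r = f' r) -> godel k f = godel k f'.
Proof. induction k as [|k IH]; intros H; cbn; [reflexivity|]. rewrite IH, H; auto. Qed.

Lemma godel_update k f r v : r < k -> godel k (update f r (v + f r)) = sylvester r ^ v * godel k f.
Proof.
  induction k as [|k IH]; intros H; [lia|]. cbn [godel].
  destruct (Nat.eq_dec r k) as [->|Hn].
  - rewrite (godel_ext k (update f k _) f).
    + unfold update. rewrite Nat.eqb_refl, Nat.pow_add_r. ring.
    + intros r Hr. unfold update. destruct (Nat.eqb_spec r k); [lia|reflexivity].
  - rewrite IH by lia. unfold update. destruct (Nat.eqb_spec k r); [lia|ring].
Qed.

Lemma godel_bezout k f r : f r = 0 -> bezout (sylvester r) (godel k f).
Proof.
  intros H. induction k as [|k IH]; cbn [godel].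
  - exists 0%Z, 1%Z. reflexivity.
  - apply bezout_mul; [exact IH|]. destruct (Nat.eq_dec r k) as [->|Hn].
    + rewrite H. exists 0%Z, 1%Z. reflexivity.
    + now apply bezout_pow, sylvester_bezout.
Qed.

(** The product is coprime to the base of an empty register, and a base is at least 2; divisibility
    by the base thus serves as the zero test. *)
Lemma godel_mod k f r : f r = 0 -> godel k f mod sylvester r <> 0.
Proof.
  intros H E. destruct (godel_bezout k f r H) as (u & v & Hb).
  apply Nat.Div0.div_exact in E. rewrite E, Nat2Z.inj_mul in Hb.
  assert (Hs := sylvester_prod_pos r). unfold sylvester in *.
  set (q := Z.of_nat (godel k f / _)) in *. set (p := Z.of_nat (S _)) in *.
  assert (2 <= p)%Z by lia.
  assert (Hd : (p * (u + v * q) = 1)%Z) by (rewrite <- Hb; ring).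
  assert (p = 1)%Z by (apply Z.divide_1_r_nonneg; [lia|exists (u + v * q)%Z; lia]). lia.
Qed.

Definition reg_of (i : instr) : nat := match i with INC r => r | DEC r _ => r end.

Section Machine.
Variables (D : program) (R : nat).
Hypothesis regs_below : forall i, In i D -> reg_of i < R.
Hypothesis R_pos : 0 < R.

Definition len : nat := length D.
Definition modulus : nat := S len.
(** Positions past the end are identified with [len], so the program counter is a residue modulo
    [len + 1] and halting is the residue [len]. *)
Definition cap (j : nat) : nat := Nat.min j len.
Definition code (c : config) : nat := modulus * godel R (snd c) + cap (fst c).

(** For [DEC], residue 0 modulo the base means a nonempty register; each of the other residues, from
    1 to [sylvester_prod r], gets its own jump rule. *)
Definition instr_rules (q : nat) (i : instr) : list rule :=
  match i with
  | INC r => [Rule modulus q (modulus * sylvester r) (cap (S q))]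
  | DEC r j => Rule (modulus * sylvester r) q modulus (cap (S q)) ::
      map (fun s => Rule (modulus * sylvester r) (modulus * s + q)
                         (modulus * sylvester r) (modulus * s + cap j))
          (seq 1 (sylvester_prod r))
  end.

(* The last rules empty the registers of a halted machine, so that there is a single final code. *)
Definition machine_rules : list rule :=
  flat_map (fun q => match nth_error D q with Some i => instr_rules q i | None => [] end) (seq 0 len)
  ++ map (fun i => Rule (modulus * sylvester i) len modulus len) (seq 0 R).

Lemma in_machine_rules ru : In ru machine_rules <->
  (exists q i, nth_error D q = Some i /\ In ru (instr_rules q i)) \/
  (exists i, i < R /\ ru = Rule (modulus * sylvester i) len modulus len).
Proof.
  unfold machine_rules. rewrite in_app_iff, in_flat_map, in_map_iff. split.
  - intros [(q & Hq & Hi)|(i & <- & Hi)].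
    + left. destruct (nth_error D q) as [i|] eqn:E; [|destruct Hi]. exists q, i; auto.
    + right. apply in_seq in Hi. exists i; split; [lia|reflexivity].
  - intros [(q & i & E & Hi)|(i & Hi & ->)].
    + left. exists q. rewrite E. split; [|assumption]. apply in_seq.
      split; [lia|]. apply nth_error_Some. congruence.
    + right. exists i. split; [reflexivity|]. apply in_seq. lia.
Qed.

Lemma step_edge c c' : step D c = Some c' -> edge machine_rules (code c) (code c').
Proof.
  destruct c as [pc f]. unfold step. destruct (nth_error D pc) as [i|] eqn:E; [|discriminate].
  assert (Hpc : pc < len) by (apply nth_error_Some; congruence).
  assert (HR := regs_below i (nth_error_In _ _ E)).
  assert (Hcap : cap pc = pc) by (unfold cap; lia).
  unfold edge, code. destruct i as [r|r j]; cbn [reg_of] in HR.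
  - intros [= <-]; cbn [fst snd].
    exists (Rule modulus pc (modulus * sylvester r) (cap (S pc))), (godel R f). repeat split.
    + apply in_machine_rules. left. exists pc, (INC r). cbn; auto.
    + cbn. now rewrite Hcap.
    + cbn [rm' rr']. change (S (f r)) with (1 + f r). rewrite (godel_update R f r 1 HR). cbn [Nat.pow]. ring.
  - destruct (f r) as [|k] eqn:Ef; intros [= <-]; cbn [fst snd].
    + assert (Hm := godel_mod R f r Ef).
      assert (Hdm := Nat.div_mod (godel R f) (sylvester r) ltac:(unfold sylvester; lia)).
      assert (Hlt := Nat.mod_upper_bound (godel R f) (sylvester r) ltac:(unfold sylvester; lia)).
      set (s := godel R f mod sylvester r) in *. set (g := godel R f / sylvester r) in *.
      exists (Rule (modulus * sylvester r) (modulus * s + pc) (modulus * sylvester r) (modulus * s + cap j)), g.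
      repeat split.
      * apply in_machine_rules. left. exists pc, (DEC r j). split; [assumption|]. right.
        apply in_map_iff. exists s. split; [reflexivity|]. apply in_seq. unfold sylvester in Hlt. lia.
      * cbn [rm rr]. rewrite Hcap, Hdm. ring.
      * cbn [rm' rr']. rewrite Hdm. ring.
    + exists (Rule (modulus * sylvester r) pc modulus (cap (S pc))), (godel R (update f r k)). repeat split.
      * apply in_machine_rules. left. exists pc, (DEC r j). cbn; auto.
      * cbn [rm rr]. rewrite Hcap.
        assert (Ek : update (update f r k) r (1 + update f r k r) = f).
        { apply FunctionalExtensionality.functional_extensionality. intros x. unfold update.
          rewrite Nat.eqb_refl. destruct (Nat.eqb_spec x r) as [->|]; [symmetry; exact Ef|reflexivity]. }
        rewrite <- Ek at 1. rewrite godel_update by assumption. cbn [Nat.pow]. ring.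
Qed.

(** The bases are removed one at a time: the power of the last base goes first, with the remaining
    factors and [q] as multiplier. *)
Lemma halted_cleanup k f q : k <= R ->
  clos_refl_trans_1n nat (edge machine_rules) (modulus * (godel k f * q) + len) (modulus * q + len).
Proof.
  revert q. induction k as [|k IH]; intros q Hk; cbn [godel].
  - rewrite Nat.mul_1_l. apply rt1n_refl.
  - specialize (IH q ltac:(lia)). generalize (f k). intros e.
    assert (E : godel k f * sylvester k ^ e * q = sylvester k ^ e * (godel k f * q)) by ring.
    rewrite E. clear E. induction e as [|e IHe].
    + now rewrite Nat.mul_1_l.
    + eapply Relation_Operators.rt1n_trans; [|apply IHe].
      exists (Rule (modulus * sylvester k) len modulus len), (sylvester k ^ e * (godel k f * q)). repeat split.
      * apply in_machine_rules. right. exists k. split; [lia|reflexivity].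
      * cbn [rm rr Nat.pow]. ring.
Qed.

Lemma halted_pc c : halted D c <-> cap (fst c) = len.
Proof.
  destruct c as [pc f]. unfold halted, step, cap, len; cbn [fst].
  split.
  - destruct (nth_error D pc) as [[r|r j]|] eqn:E; [discriminate|destruct (f r); discriminate|].
    intros _. apply nth_error_None in E. lia.
  - intros H. assert (E : nth_error D pc = None) by (apply nth_error_None; lia). now rewrite E.
Qed.

Lemma halting_path c k : halted D (steps D k c) ->
  clos_refl_trans_1n nat (edge machine_rules) (code c) (modulus + len).
Proof.
  assert (Hdone : forall c, halted D c -> clos_refl_trans_1n nat (edge machine_rules) (code c) (modulus + len)).
  { intros [pc f] Hh. apply halted_pc in Hh. unfold code. rewrite Hh. cbn [snd].
    assert (P := halted_cleanup R f 1 (le_n R)). now rewrite !Nat.mul_1_r in P. }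
  revert c. induction k as [|k IH]; intros c; cbn [steps]; [apply Hdone|].
  destruct (step D c) as [c'|] eqn:E; [|apply Hdone].
  intros H. eapply Relation_Operators.rt1n_trans; [apply step_edge; exact E|]. apply IH, H.
Qed.

(** * Determinism of the rules on integer codes *)

Local Open Scope Z_scope.

(** Negative integers are included because the marking has to be invariant on whole progressions. *)
Definition edgeZ (a b : Z) : Prop := exists ru j, In ru machine_rules /\
  a = Z.of_nat (rm ru) * j + Z.of_nat (rr ru) /\ b = Z.of_nat (rm' ru) * j + Z.of_nat (rr' ru).

(** The successor as dictated by the residues of the code. It is left open only at a halted
    position, where it has to be halted again. *)
Definition next (a b : Z) : Prop :=
  let q := Z.to_nat (a mod Z.of_nat modulus) in let g := a / Z.of_nat modulus in
  match nth_error D q with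
  | None => b mod Z.of_nat modulus = Z.of_nat len
  | Some (INC r) => b = Z.of_nat modulus * (Z.of_nat (sylvester r) * g) + Z.of_nat (cap (S q))
  | Some (DEC r j) =>
      if g mod Z.of_nat (sylvester r) =? 0
      then b = Z.of_nat modulus * (g / Z.of_nat (sylvester r)) + Z.of_nat (cap (S q))
      else b = Z.of_nat modulus * g + Z.of_nat (cap j)
  end.

Lemma decompose g q : (q <= len)%nat ->
  (Z.of_nat modulus * g + Z.of_nat q) / Z.of_nat modulus = g /\
  (Z.of_nat modulus * g + Z.of_nat q) mod Z.of_nat modulus = Z.of_nat q.
Proof.
  intros H. unfold modulus in *.
  rewrite Z.add_comm, Z.mul_comm, Z.div_add, Z.mod_add, Z.div_small, Z.mod_small by lia. lia.
Qed.

Lemma edgeZ_next a b : edgeZ a b -> next a b.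
Proof.
  intros (ru & j & Hru & -> & ->).
  apply in_machine_rules in Hru as [(q & i & E & Hi)|(i & Hi & ->)].
  - assert (Hq : (q < len)%nat) by (apply nth_error_Some; congruence).
    destruct i as [r|r t]; cbn [instr_rules] in Hi.
    + destruct Hi as [<- | []]; cbn [rm rr rm' rr'].
      unfold next. destruct (decompose j q ltac:(lia)) as [-> ->].
      rewrite Nat2Z.id, E, Nat2Z.inj_mul. ring.
    + destruct Hi as [<- | Hi].
      * cbn [rm rr rm' rr']. unfold next. rewrite Nat2Z.inj_mul, <- Z.mul_assoc.
        destruct (decompose (Z.of_nat (sylvester r) * j) q ltac:(lia)) as [-> ->].
        rewrite Nat2Z.id, E, (Z.mul_comm (Z.of_nat (sylvester r))).
        rewrite Z.mod_mul, Z.div_mul by (unfold sylvester; lia). reflexivity.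
      * apply in_map_iff in Hi as (s & <- & Hs). apply in_seq in Hs.
        cbn [rm rr rm' rr']. rewrite !Nat2Z.inj_add, !Nat2Z.inj_mul.
        replace (Z.of_nat modulus * Z.of_nat (sylvester r) * j + (Z.of_nat modulus * Z.of_nat s + Z.of_nat q))
          with (Z.of_nat modulus * (Z.of_nat s + j * Z.of_nat (sylvester r)) + Z.of_nat q) by ring.
        unfold next.
        destruct (decompose (Z.of_nat s + j * Z.of_nat (sylvester r)) q ltac:(lia)) as [-> ->].
        rewrite Nat2Z.id, E. rewrite Z.mod_add by (unfold sylvester; lia).
        rewrite Z.mod_small by (unfold sylvester; lia).
        destruct (Z.eqb_spec (Z.of_nat s) 0); [lia|]. ring.
  - cbn [rm rr rm' rr']. rewrite Nat2Z.inj_mul, <- Z.mul_assoc. unfold next.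
    destruct (decompose (Z.of_nat (sylvester i) * j) len ltac:(lia)) as [-> ->].
    rewrite Nat2Z.id. rewrite (proj2 (nth_error_None D len)) by (unfold len; lia).
    apply decompose. lia.
Qed.

Definition final (a : Z) : Prop := a mod Z.of_nat modulus = Z.of_nat len.

Definition reaches_final (a : Z) : Prop := exists b, clos_refl_trans_1n Z edgeZ a b /\ final b.

Lemma final_next a b : final a -> next a b -> final b.
Proof.
  unfold final, next. intros ->. rewrite Nat2Z.id.
  rewrite (proj2 (nth_error_None D len)) by (unfold len; lia). auto.
Qed.

Lemma next_deterministic a b b' : ~ final a -> next a b -> next a b' -> b = b'.
Proof.
  unfold final, next. intros Hf.
  destruct (nth_error D _) as [[r|r j]|] eqn:E.
  - congruence.
  - destruct (_ =? _); congruence.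
  - exfalso. apply Hf. apply nth_error_None in E. fold len in E.
    assert (Hb := Z.mod_pos_bound a (Z.of_nat modulus) ltac:(unfold modulus; lia)).
    unfold modulus in *. lia.
Qed.

(** The successor of a code that is not final is unique, and a final code has only final
    successors. *)
Lemma reaches_final_edge a b : edgeZ a b -> reaches_final a <-> reaches_final b.
Proof.
  intros Hab. split.
  - intros (c & Hp & Hc).
    destruct (classic (final a)) as [Hf|Hf].
    + exists b. split; [apply rt1n_refl|]. eapply final_next; [exact Hf|now apply edgeZ_next].
    + destruct Hp as [|a1 c Ha1 Hp]; [contradiction|].
      rewrite (next_deterministic a b a1 Hf); [exists c; auto|now apply edgeZ_next|now apply edgeZ_next].
  - intros (c & Hp & Hc). exists c. split; [eapply Relation_Operators.rt1n_trans; eassumption|assumption].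
Qed.

Lemma code_final c : final (Z.of_nat (code c)) <-> halted D c.
Proof.
  rewrite halted_pc. unfold final, code. rewrite Nat2Z.inj_add, Nat2Z.inj_mul.
  destruct (decompose (Z.of_nat (godel R (snd c))) (cap (fst c))) as [_ ->]; [unfold cap; lia|]. lia.
Qed.

(** By determinism a path of edges follows the run of the machine until that run halts. *)
Lemma reaches_final_halts c : reaches_final (Z.of_nat (code c)) -> exists k, halted D (steps D k c).
Proof.
  intros (b & Hp & Hb). remember (Z.of_nat (code c)) as a eqn:Ea. revert c Ea.
  induction Hp as [a|a a1 b Ha Hp IH]; intros c ->.
  - exists 0%nat. now apply code_final.
  - destruct (step D c) as [c'|] eqn:E; [|exists 0%nat; exact E].
    destruct (IH Hb c') as [k Hk].
    + apply (next_deterministic (Z.of_nat (code c))).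
      * rewrite code_final. unfold halted. congruence.
      * now apply edgeZ_next.
      * apply edgeZ_next. destruct (step_edge c c' E) as (ru & j & H1 & H2 & H3).
        exists ru, (Z.of_nat j). split; [exact H1|]. lia.
    + exists (S k). cbn [steps]. now rewrite E.
Qed.

Definition nonhalting (a : Z) : bool :=
  if excluded_middle_informative (reaches_final a) then false else true.

Lemma machine_rules_ok : Forall (rule_ok nonhalting) machine_rules.
Proof.
  apply Forall_forall. intros ru Hru.
  assert (Hpos : (0 < rm ru /\ 0 < rm' ru)%nat).
  { apply in_machine_rules in Hru as [(q & i & _ & Hi)|(i & _ & ->)].
    - destruct i as [r|r t]; cbn [instr_rules] in Hi; [destruct Hi as [<- | []]|destruct Hi as [<- | Hi]];
        try (apply in_map_iff in Hi as (s & <- & _)); cbn [rm rm']; unfold modulus, sylvester; lia.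
    - cbn [rm rm']; unfold modulus, sylvester; lia. }
  repeat split; [apply Hpos|apply Hpos|]. intros j. unfold nonhalting.
  assert (He := reaches_final_edge _ _ (ex_intro _ ru (ex_intro _ j (conj Hru (conj eq_refl eq_refl))))).
  destruct (excluded_middle_informative _), (excluded_middle_informative _); tauto.
Qed.

(** The base of register 0 is [sylvester 0], which is 2. *)
Lemma code_init x : code (init x) = (2 ^ x * modulus)%nat.
Proof.
  unfold code, init; cbn [fst snd].
  assert (G : forall k, godel (S k) (fun r => if Nat.eqb r 0 then x else 0%nat) = (2 ^ x)%nat).
  { induction k as [|k IH]; cbn [godel] in *.
    - now rewrite Nat.mul_1_l.
    - rewrite IH. cbn [Nat.eqb Nat.pow]. lia. }
  destruct R as [|k]; [lia|]. rewrite G. unfold cap. cbn [Nat.min]. lia.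
Qed.

(** The final code [modulus + len] has all registers empty. The factors $2^x$ and [modulus] of the
    initial code serve as $n$ and $L$. *)
Theorem machine_group x :
  semigroup_is_group (instance_gens (pair_instance (rules_gens (modulus + len) modulus machine_rules (2 ^ x))))
  <-> exists k, halted D (steps D k (init x)).
Proof.
  split.
  - intros Hg. apply NNPP. intros Hn. revert Hg.
    apply rules_not_group with (chi := nonhalting).
    + apply machine_rules_ok.
    + unfold nonhalting. destruct (excluded_middle_informative _) as [_|Hf]; [reflexivity|].
      exfalso. apply Hf. exists (Z.of_nat (modulus + len)). split; [apply rt1n_refl|].
      unfold final. assert (E := decompose 1 len ltac:(lia)).
      rewrite Nat2Z.inj_add, <- (Z.mul_1_r (Z.of_nat modulus)) at 1. apply E.
    + rewrite <- code_init. unfold nonhalting.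
      destruct (excluded_middle_informative _) as [Hf|_]; [|reflexivity].
      exfalso. apply Hn. now apply reaches_final_halts.
  - intros [k Hk]. apply rules_group. rewrite <- code_init. now apply (halting_path _ k).
Qed.

End Machine.

(** * Structured counter programs *)

Definition state := nat -> nat.

Inductive cmd :=
| Skip
| Inc (r : nat)
| Dec (r : nat)
| Seq (c d : cmd)
| Loop (r : nat) (c : cmd).

Inductive runs : cmd -> state -> state -> Prop :=
| runs_skip f : runs Skip f f
| runs_inc r f : runs (Inc r) f (update f r (S (f r)))
| runs_dec r f : runs (Dec r) f (update f r (pred (f r)))
| runs_seq c d f g h : runs c f g -> runs d g h -> runs (Seq c d) f h
| runs_loop_0 r c f : f r = 0 -> runs (Loop r c) f f
| runs_loop_S r c k f g h : f r = S k -> runs c (update f r k) g -> runs (Loop r c) g h ->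
    runs (Loop r c) f h.

Fixpoint size (c : cmd) : nat :=
  match c with
  | Skip => 0 | Inc _ => 1 | Dec _ => 1
  | Seq c d => size c + size d
  | Loop _ c => 2 + size c
  end.

(* Register z stays 0, so that DEC z j is an unconditional jump. *)
Fixpoint compile (z o : nat) (c : cmd) : program :=
  match c with
  | Skip => []
  | Inc r => [INC r]
  | Dec r => [DEC r (S o)]
  | Seq c d => compile z o c ++ compile z (o + size c) d
  | Loop r c => DEC r (o + (2 + size c)) :: compile z (S o) c ++ [DEC z o]
  end.

Fixpoint regs_bound (c : cmd) : nat :=
  match c with
  | Skip => 0
  | Inc r | Dec r => S r
  | Seq c d => Nat.max (regs_bound c) (regs_bound d)
  | Loop r c => Nat.max (S r) (regs_bound c)
  end.

Lemma compile_length z o c : length (compile z o c) = size c.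
Proof.
  revert o; induction c as [|r|r|c IHc d IHd|r c IH]; intros o; cbn; try reflexivity.
  - now rewrite length_app, IHc, IHd.
  - rewrite length_app, IH; cbn. lia.
Qed.

Lemma update_same f r v : update f r v r = v.
Proof. unfold update. now rewrite Nat.eqb_refl. Qed.

Lemma update_other f r v r' : r' <> r -> update f r v r' = f r'.
Proof. intros H. unfold update. now rewrite (proj2 (Nat.eqb_neq r' r) H). Qed.

Lemma steps_halted P n c : halted P c -> steps P n c = c.
Proof. intros H. destruct n; [reflexivity|]. cbn. now rewrite H. Qed.

Lemma steps_add P m n c : steps P (m + n) c = steps P n (steps P m c).
Proof.
  revert c; induction m as [|m IH]; intros c; [reflexivity|]. cbn.
  destruct (step P c) as [c'|] eqn:E; [apply IH|]. now rewrite steps_halted.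
Qed.

Definition reaches (P : program) (c d : config) : Prop := exists n, steps P n c = d.

Lemma reaches_trans P c d e : reaches P c d -> reaches P d e -> reaches P c e.
Proof. intros [m <-] [n <-]. exists (m + n). apply steps_add. Qed.

Lemma reaches_step P c d : step P c = Some d -> reaches P c d.
Proof. intros E. exists 1. cbn. now rewrite E. Qed.

Lemma nth_error_middle {A} (u v : list A) a : nth_error (u ++ a :: v) (length u) = Some a.
Proof. rewrite nth_error_app2, Nat.sub_diag by lia. reflexivity. Qed.

(** Compiled code must work inside any larger program, with jump targets given by the length of what
    precedes it; the induction places subcommands this way. *)
Lemma compile_correct z c f g : runs c f g -> regs_bound c <= z -> f z = 0 ->
  g z = 0 /\ forall u v, reaches (u ++ compile z (length u) c ++ v) (length u, f) (length u + size c, g).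
Proof.
  induction 1 as [f|r f|r f|c d f g h _ IHc _ IHd|r c f E|r c k f g h E _ IHc _ IHl];
    cbn [regs_bound size compile]; intros Hz Hf.
  - split; [assumption|]. intros u v. exists 0. cbn. now rewrite Nat.add_0_r.
  - rewrite update_other by lia. split; [assumption|]. intros u v. apply reaches_step.
    unfold step. cbn [app]. rewrite nth_error_middle. f_equal. f_equal. lia.
  - rewrite update_other by lia. split; [assumption|]. intros u v. apply reaches_step.
    unfold step. cbn [app]. rewrite nth_error_middle, Nat.add_1_r. destruct (f r) as [|k] eqn:E.
    (* On an empty register [DEC] jumps to the following instruction, in agreement with
       [pred 0 = 0]. *)
    + f_equal. f_equal. apply functional_extensionality. intros x. cbn.
      unfold update. destruct (Nat.eqb_spec x r); congruence.
    + reflexivity.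
  - destruct (IHc ltac:(lia) Hf) as [Hg Rc]. destruct (IHd ltac:(lia) Hg) as [Hh Rd].
    split; [assumption|]. intros u v. eapply reaches_trans.
    + rewrite <- app_assoc. apply Rc.
    + specialize (Rd (u ++ compile z (length u) c) v).
      rewrite length_app, compile_length, <- !app_assoc in Rd. rewrite <- app_assoc, Nat.add_assoc. exact Rd.
  - split; [assumption|]. intros u v. apply reaches_step.
    unfold step. cbn [app]. now rewrite nth_error_middle, E.
  - assert (Hf' : update f r k z = 0) by (rewrite update_other by lia; assumption).
    destruct (IHc ltac:(lia) Hf') as [Hg Rc]. destruct (IHl Hz Hg) as [Hh Rl].
    split; [assumption|]. intros u v. specialize (Rl u v). cbn [compile size] in Rl.
    eapply reaches_trans; [|exact Rl]. clear Rl.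
    apply (reaches_trans _ _ (S (length u), update f r k)).
    { apply reaches_step. unfold step. cbn [app]. now rewrite nth_error_middle, E. }
    apply (reaches_trans _ _ (S (length u) + size c, g)).
    + specialize (Rc (u ++ [DEC r (length u + (2 + size c))]) ([DEC z (length u)] ++ v)).
      rewrite length_app in Rc. cbn [length] in Rc. rewrite Nat.add_1_r in Rc.
      rewrite <- app_assoc in Rc. cbn [app] in *. rewrite <- app_assoc. exact Rc.
    + apply reaches_step. unfold step.
      assert (N := nth_error_middle (u ++ DEC r (length u + (2 + size c)) :: compile z (S (length u)) c) v (DEC z (length u))).
      rewrite length_app in N. cbn [length] in N. rewrite compile_length in N.
      rewrite <- app_assoc in N. cbn [app] in *. rewrite <- app_assoc. cbn [app].
      replace (S (length u) + size c) with (length u + S (size c)) by lia.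
      now rewrite N, Hg.
Qed.

Ltac state_eq := apply functional_extensionality; intros ?x; unfold update;
  repeat match goal with |- context [Nat.eqb ?a ?b] => destruct (Nat.eqb_spec a b) end; subst; try lia; try congruence.

Lemma runs_eq c f g g' : runs c f g -> g = g' -> runs c f g'.
Proof. intros H <-. exact H. Qed.

Lemma runs_clear r f : runs (Loop r Skip) f (update f r 0).
Proof.
  remember (f r) as k eqn:E. revert f E. induction k as [|k IH]; intros f E.
  - eapply runs_eq; [apply runs_loop_0; symmetry; exact E|]. state_eq.
  - eapply runs_loop_S; [symmetry; exact E|apply runs_skip|].
    eapply runs_eq; [apply IH; now rewrite update_same|]. state_eq.
Qed.

Lemma runs_move r s f : r <> s ->
  runs (Loop r (Inc s)) f (update (update f r 0) s (f r + f s)).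
Proof.
  intros Hn. remember (f r) as k eqn:E. revert f E. induction k as [|k IH]; intros f E.
  - eapply runs_eq; [apply runs_loop_0; symmetry; exact E|]. state_eq.
  - eapply runs_loop_S; [symmetry; exact E|apply runs_inc|].
    eapply runs_eq; [apply IH|].
    + rewrite update_other, update_same by assumption. reflexivity.
    + rewrite update_same, update_other by auto. state_eq.
Qed.

Lemma runs_copy r s t f : r <> s -> r <> t -> s <> t ->
  runs (Loop r (Seq (Inc s) (Inc t))) f (update (update (update f r 0) s (f r + f s)) t (f r + f t)).
Proof.
  intros Hrs Hrt Hst. remember (f r) as k eqn:E. revert f E. induction k as [|k IH]; intros f E.
  - eapply runs_eq; [apply runs_loop_0; symmetry; exact E|]. state_eq.
  - eapply runs_loop_S; [symmetry; exact E|eapply runs_seq; apply runs_inc|].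
    eapply runs_eq; [apply IH|].
    + rewrite !update_other, update_same by assumption. reflexivity.
    + rewrite ?update_same, ?(update_other _ s _ t), ?(update_other _ r _ t), ?(update_other _ t _ s),
        ?update_same, ?(update_other _ r _ s) by auto. state_eq.
Qed.

(** * Computable functions of the registers *)

Definition computes (b : nat) (F : state -> nat) (c : cmd) : Prop :=
  forall f, (forall r, b <= r -> f r = 0) -> runs c f (update f b (F f)).

Definition depends_below (k : nat) (F : state -> nat) : Prop :=
  forall f g, (forall r, r < k -> f r = g r) -> F f = F g.

(* F uses the registers below k and can be computed into every register b >= k with the registers above b as scratch space. *)
Definition computable (k : nat) (F : state -> nat) : Prop :=
  depends_below k F /\ forall b, k <= b -> exists c, computes b F c.

Lemma computable_ext k F G : (forall f, F f = G f) -> computable k F -> computable k G.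
Proof.
  intros H [H1 H2]. split.
  - intros f g Hfg. rewrite <- !H. now apply H1.
  - intros b Hb. destruct (H2 b Hb) as [c Hc]. exists c. intros f Hf. rewrite <- H. now apply Hc.
Qed.

Lemma computable_weaken k k' F : k <= k' -> computable k F -> computable k' F.
Proof.
  intros Hk [H1 H2]. split.
  - intros f g Hfg. apply H1. intros r Hr. apply Hfg. lia.
  - intros b Hb. apply H2. lia.
Qed.

Lemma computable_zero k : computable k (fun _ => 0).
Proof.
  split; [easy|]. intros b _. exists Skip. intros f Hf.
  eapply runs_eq; [apply runs_skip|]. assert (E := Hf b (le_n b)). state_eq.
Qed.

Lemma computable_succ k F : computable k F -> computable k (fun f => S (F f)).
Proof.
  intros [H1 H2]. split; [intros f g Hfg; f_equal; now apply H1|].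
  intros b Hb. destruct (H2 b Hb) as [c Hc]. exists (Seq c (Inc b)). intros f Hf.
  eapply runs_seq; [now apply Hc|]. eapply runs_eq; [apply runs_inc|]. rewrite update_same. state_eq.
Qed.

Lemma computable_pred k F : computable k F -> computable k (fun f => pred (F f)).
Proof.
  intros [H1 H2]. split; [intros f g Hfg; f_equal; now apply H1|].
  intros b Hb. destruct (H2 b Hb) as [c Hc]. exists (Seq c (Dec b)). intros f Hf.
  eapply runs_seq; [now apply Hc|]. eapply runs_eq; [apply runs_dec|]. rewrite update_same. state_eq.
Qed.

Lemma computable_const k n : computable k (fun _ => n).
Proof.
  induction n as [|n IH]; [apply computable_zero|]. exact (computable_succ _ _ IH).
Qed.

(** Reading a register empties it, so its content goes to [b] and [S b] together and is then moved
    back from [S b]. *)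
Lemma computable_reg k r : r < k -> computable k (fun f => f r).
Proof.
  intros Hr. split; [intros f g H; now apply H|]. intros b Hb.
  exists (Seq (Loop r (Seq (Inc b) (Inc (S b)))) (Loop (S b) (Inc r))). intros f Hf.
  eapply runs_seq; [apply runs_copy; lia|]. eapply runs_eq; [apply runs_move; lia|].
  assert (E1 := Hf b ltac:(lia)). assert (E2 := Hf (S b) ltac:(lia)).
  rewrite update_same, !(update_other _ _ _ r), update_same by lia. rewrite E1, E2, !Nat.add_0_r. state_eq.
Qed.

(** The value of [F] waits in register [b] while [G] is computed into [S b]; then [b] is cleared and
    receives the result. *)
Lemma computable_let k F (G : state -> nat -> nat) :
  computable k F -> (forall v, depends_below k (fun f => G f v)) ->
  (forall b, k <= b -> computable (S b) (fun f => G f (f b))) -> computable k (fun f => G f (F f)).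
Proof.
  intros [F1 F2] G1 G2. split.
  - intros f g Hfg. rewrite (F1 f g Hfg). now apply G1.
  - intros b Hb. destruct (F2 b Hb) as [c Hc]. destruct (proj2 (G2 b Hb) (S b) (le_n _)) as [d Hd].
    exists (Seq c (Seq d (Seq (Loop b Skip) (Loop (S b) (Inc b))))). intros f Hf.
    eapply runs_seq; [now apply Hc|]. eapply runs_seq.
    { apply Hd. intros r Hr. rewrite update_other by lia. apply Hf. lia. }
    eapply runs_seq; [apply runs_clear|]. eapply runs_eq; [apply runs_move; lia|].
    rewrite (update_other _ b _ (S b)), !update_same by lia.
    rewrite (G1 (F f) (update f b (F f)) f) by (intros r Hr; apply update_other; lia).
    assert (E := Hf (S b) ltac:(lia)). rewrite Nat.add_0_r. state_eq.
Qed.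

Lemma computable_iter k N I (St : state -> nat -> nat) :
  computable k N -> computable k I -> (forall v, depends_below k (fun f => St f v)) ->
  (forall b, k <= b -> computable (S b) (fun f => St f (f b))) ->
  computable k (fun f => Nat.iter (N f) (St f) (I f)).
Proof.
  intros [N1 N2] [I1 I2] S1 S2. split.
  - intros f g Hfg. rewrite (N1 f g Hfg), (I1 f g Hfg).
    generalize (N g) as n. induction n as [|n IH]; [reflexivity|].
    rewrite !Nat.iter_succ, IH. now apply S1.
  - intros b Hb. destruct (N2 b Hb) as [cN HN]. destruct (I2 (S b) ltac:(lia)) as [cI HI].
    destruct (proj2 (S2 (S b) ltac:(lia)) (S (S b)) (le_n _)) as [cS HS].
    (* Register [b] counts the passes, [S b] holds the current value, and [S (S b)] the next one. *)
    set (body := Seq cS (Seq (Loop (S b) Skip) (Loop (S (S b)) (Inc (S b))))).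
    exists (Seq cN (Seq cI (Seq (Loop b body) (Loop (S b) (Inc b))))). intros f Hf.
    assert (Hloop : forall n v, runs (Loop b body) (update (update f b n) (S b) v)
      (update f (S b) (Nat.iter n (St f) v))).
    { assert (E0 := Hf b ltac:(lia)). assert (E1 := Hf (S (S b)) ltac:(lia)).
      induction n as [|n IH]; intros v.
      - eapply runs_eq; [apply runs_loop_0; rewrite update_other, update_same by lia; reflexivity|].
        cbn. state_eq.
      - set (g := update (update f b n) (S b) v).
        assert (Eg : St g (g (S b)) = St f v).
        { unfold g at 2. rewrite update_same. apply S1. intros r Hr. unfold g. rewrite !update_other by lia. reflexivity. }
        apply runs_loop_S with (k := n) (g := update (update f b n) (S b) (St f v)).
        + rewrite update_other, update_same by lia. reflexivity.
        + replace (update _ b n) with g by (unfold g; state_eq).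
          unfold body. eapply runs_seq.
          { apply HS. intros r Hr. unfold g. rewrite !update_other by lia. apply Hf. lia. }
          rewrite Eg. eapply runs_seq; [apply runs_clear|]. eapply runs_eq; [apply runs_move; lia|].
          rewrite (update_other _ (S b) _ (S (S b))), !update_same, Nat.add_0_r by lia. unfold g. state_eq.
        + rewrite Nat.iter_succ_r. apply IH. }
    eapply runs_seq; [now apply HN|]. eapply runs_seq.
    { apply HI. intros r Hr. rewrite update_other by lia. apply Hf. lia. }
    rewrite (I1 (update f b (N f)) f) by (intros r Hr; apply update_other; lia).
    eapply runs_seq; [apply Hloop|]. eapply runs_eq; [apply runs_move; lia|].
    rewrite update_same, update_other by lia.
    assert (E0 := Hf b ltac:(lia)). assert (E1 := Hf (S b) ltac:(lia)). rewrite E0, Nat.add_0_r. state_eq.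
Qed.

Definition computable2 (op : nat -> nat -> nat) : Prop :=
  forall k F G, computable k F -> computable k G -> computable k (fun f => op (F f) (G f)).

Lemma computable2_intro op :
  (forall k a b, a < k -> b < k -> computable k (fun f => op (f a) (f b))) -> computable2 op.
Proof.
  intros H k F G HF HG. apply (computable_let k F (fun f v => op v (G f))); [assumption| |].
  - intros v f g Hfg. f_equal. now apply HG.
  - intros b Hb. apply (computable_let (S b) G (fun f w => op (f b) w)).
    + apply (computable_weaken k); [lia|assumption].
    + intros w f g Hfg. now rewrite (Hfg b ltac:(lia)).
    + intros b' Hb'. apply H; lia.
Qed.

Lemma depends_reg k r (h : nat -> nat) : r < k -> depends_below k (fun f => h (f r)).
Proof. intros Hr f g H. now rewrite H. Qed.

Lemma depends_const k v : depends_below k (fun _ => v).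
Proof. easy. Qed.

Lemma computable_add : computable2 Nat.add.
Proof.
  apply computable2_intro. intros k a b Ha Hb.
  apply (computable_ext _ (fun f => Nat.iter (f a) S (f b))).
  { intros f. induction (f a) as [|n IH]; [reflexivity|]. now rewrite Nat.iter_succ, IH. }
  apply (computable_iter k _ _ (fun _ v => S v)); try (apply computable_reg; lia).
  - intros v. apply depends_const.
  - intros b' Hb'. apply computable_succ, computable_reg. lia.
Qed.

Lemma computable_mul : computable2 Nat.mul.
Proof.
  apply computable2_intro. intros k a b Ha Hb.
  apply (computable_ext _ (fun f => Nat.iter (f a) (fun v => f b + v) 0)).
  { intros f. induction (f a) as [|n IH]; [reflexivity|]. now rewrite Nat.iter_succ, IH. }
  apply (computable_iter k _ _ (fun f v => f b + v)).
  - now apply computable_reg.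
  - apply computable_const.
  - intros v. now apply (depends_reg k b (fun x => x + v)).
  - intros b' Hb'. apply computable_add; apply computable_reg; lia.
Qed.

Lemma computable_pow : computable2 Nat.pow.
Proof.
  apply computable2_intro. intros k a b Ha Hb.
  apply (computable_ext _ (fun f => Nat.iter (f b) (fun v => f a * v) 1)).
  { intros f. induction (f b) as [|n IH]; [reflexivity|]. now rewrite Nat.iter_succ, IH. }
  apply (computable_iter k _ _ (fun f v => f a * v)).
  - now apply computable_reg.
  - apply computable_const.
  - intros v. now apply (depends_reg k a (fun x => x * v)).
  - intros b' Hb'. apply computable_mul; apply computable_reg; lia.
Qed.

Lemma computable_sub : computable2 Nat.sub.
Proof.
  apply computable2_intro. intros k a b Ha Hb.
  apply (computable_ext _ (fun f => Nat.iter (f b) pred (f a))).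
  { intros f. induction (f b) as [|n IH]; [cbn; lia|]. rewrite Nat.iter_succ, IH. lia. }
  apply (computable_iter k _ _ (fun _ v => pred v)); try (apply computable_reg; lia).
  - intros v. apply depends_const.
  - intros b' Hb'. apply computable_pred, computable_reg. lia.
Qed.

(* The guard 1 - (y - x) is 1 exactly when y <= x. *)
Definition nat_mod (a b : nat) : nat := Nat.iter a (fun v => v - b * (1 - (b - v))) a.
Definition nat_div (a b : nat) : nat := Nat.iter a (fun v => v + (1 - (b * S v - a))) 0.

Lemma nat_mod_eq a b : b <> 0 -> nat_mod a b = a mod b.
Proof.
  intros Hb. unfold nat_mod.
  (* Each subtraction removes at least 1, so as many passes as the value suffice; once the value is
     below [b], further passes fix it. *)
  assert (H : forall n v, v <= n -> Nat.iter n (fun v => v - b * (1 - (b - v))) v = v mod b).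
  { induction n as [|n IH]; intros v Hv.
    - replace v with 0 by lia. now rewrite Nat.Div0.mod_0_l.
    - rewrite Nat.iter_succ_r. destruct (Nat.lt_ge_cases v b) as [Hlt|Hge].
      + replace (v - b * (1 - (b - v))) with v by nia.
        rewrite Nat.mod_small by assumption. clear - Hlt.
        induction n as [|n IH]; [reflexivity|]. rewrite Nat.iter_succ, IH. nia.
      + replace (v - b * (1 - (b - v))) with (v - b) by nia.
        rewrite IH by lia. replace v with (v - b + 1 * b) at 2 by lia.
        now rewrite Nat.Div0.mod_add. }
  now apply H.
Qed.

Lemma nat_div_eq a b : b <> 0 -> nat_div a b = a / b.
Proof.
  intros Hb. unfold nat_div.
  assert (Hdm := Nat.div_mod a b Hb). assert (Hlt := Nat.mod_upper_bound a b Hb).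
  assert (H : forall n, Nat.iter n (fun v => v + (1 - (b * S v - a))) 0 = Nat.min n (a / b)).
  { induction n as [|n IH]; [reflexivity|]. rewrite Nat.iter_succ, IH.
    destruct (Nat.lt_ge_cases n (a / b)) as [Hn|Hn].
    - rewrite !Nat.min_l by lia. assert (b * S n <= b * (a / b)) by (apply Nat.mul_le_mono_l; lia). lia.
    - rewrite !Nat.min_r by lia. rewrite Nat.mul_succ_r. lia. }
  rewrite H. apply Nat.min_r. rewrite Hdm at 2. nia.
Qed.

Lemma computable_mod : computable2 nat_mod.
Proof.
  apply computable2_intro. intros k a b Ha Hb. unfold nat_mod.
  apply (computable_iter k _ _ (fun f v => v - f b * (1 - (f b - v)))); try now apply computable_reg.
  - intros v. now apply (depends_reg k b (fun x => v - x * (1 - (x - v)))).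
  - intros b' Hb'. repeat first [apply computable_sub | apply computable_mul | apply computable_const];
      apply computable_reg; lia.
Qed.

Lemma computable_div : computable2 nat_div.
Proof.
  apply computable2_intro. intros k a b Ha Hb. unfold nat_div.
  apply (computable_iter k _ _ (fun f v => v + (1 - (f b * S v - f a)))).
  - now apply computable_reg.
  - apply computable_const.
  - intros v f g H. now rewrite (H a Ha), (H b Hb).
  - intros b' Hb'. repeat first [apply computable_add | apply computable_sub | apply computable_mul
      | apply computable_const | apply computable_succ]; apply computable_reg; lia.
Qed.

Lemma computable_npair : computable2 npair.
Proof.
  intros k F G HF HG.
  apply (computable_ext _ (fun f => nat_div ((F f + G f) * (F f + G f + 1)) 2 + G f)).
  { intros f. unfold npair. now rewrite nat_div_eq. }
  repeat first [assumption | apply computable_add | apply computable_mul | apply computable_div | apply computable_const].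
Qed.

(** * Computing the code of an instance *)

Lemma expand_xpow n : expand (xpow n) = repeat (true, true) n.
Proof.
  induction n as [|n IH]; [reflexivity|].
  change (expand (xpow (S n))) with ((true, true) :: expand (xpow n)). now rewrite IH.
Qed.

Lemma expand_winv_xpow n : expand (winv (xpow n)) = repeat (true, false) n.
Proof.
  rewrite expand_winv, expand_xpow. unfold winv. now rewrite map_repeat, rev_repeat.
Qed.

(* (3 + 4i)^n = a + b i; replacing i by B shows that (3 + 4B)^n is a + b B modulo B^2 + 1. *)
Lemma gauss_power (n : nat) (B : Z) : exists a b t : Z,
  zval (repeat (true, true) n) = ZQuat a b 0 0 /\ zval (repeat (true, false) n) = ZQuat a (- b) 0 0 /\
  (a * a + b * b = 5 ^ Z.of_nat n * 5 ^ Z.of_nat n)%Z /\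
  ((3 + 4 * B) ^ Z.of_nat n = a + b * B + t * (B * B + 1))%Z.
Proof.
  induction n as [|n (a & b & t & H1 & H2 & H3 & H4)].
  - exists 1%Z, 0%Z, 0%Z. repeat split; cbn; ring.
  - exists (3 * a - 4 * b)%Z, (3 * b + 4 * a)%Z, (t * (3 + 4 * B) + 4 * b)%Z. repeat split.
    + change (zval (repeat (true, true) (S n)))
        with (zmul (ZQuat 3 4 0 0) (zval (repeat (true, true) n))).
      rewrite H1. unfold zmul; cbn [za zb zc zd]. f_equal; ring.
    + change (zval (repeat (true, false) (S n)))
        with (zmul (ZQuat 3 (-4) 0 0) (zval (repeat (true, false) n))).
      rewrite H2. unfold zmul; cbn [za zb zc zd]. f_equal; ring.
    + rewrite Nat2Z.inj_succ, Z.pow_succ_r by lia.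
      transitivity (25 * (a * a + b * b))%Z; [ring|]. rewrite H3. ring.
    + rewrite Nat2Z.inj_succ, Z.pow_succ_r, H4 by lia. ring.
Qed.

Definition den (n : nat) : nat := 5 ^ n.
Definition base (n : nat) : nat := 2 * den n + 1.

(* The two coordinates, shifted by 5^n so as to be natural numbers, are the digits of this number in base B. *)
Definition packed (n : nat) : nat :=
  nat_mod ((3 + 4 * base n) ^ n + (den n + den n * base n)) (base n * base n + 1).

(** This is [encZ] of $A-M$ by truncated subtraction: at most one difference is nonzero, and for
    $A=M$ subtracting 1 still leaves 0. *)
Definition code_shifted (A M : nat) : nat := 2 * (M - A) + (2 * (A - M) - 1).

Lemma code_shifted_encZ A M z : (Z.of_nat A = z + Z.of_nat M)%Z ->
  code_shifted A M = encZ z /\ code_shifted M A = encZ (- z).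
Proof.
  intros H. unfold code_shifted. destruct z as [|p|p]; cbn [Z.opp encZ]; lia.
Qed.

(** The norm bounds both coordinates by $5^n$ in absolute value. Shifted, they are digits below the
    base $B$, and the number they form is smaller than $B^2+1$, hence equal to the remainder. *)
Lemma packed_digits n a b t :
  (a * a + b * b = 5 ^ Z.of_nat n * 5 ^ Z.of_nat n)%Z ->
  ((3 + 4 * Z.of_nat (base n)) ^ Z.of_nat n
    = a + b * Z.of_nat (base n) + t * (Z.of_nat (base n) * Z.of_nat (base n) + 1))%Z ->
  Z.of_nat (nat_mod (packed n) (base n)) = (a + Z.of_nat (den n))%Z /\
  Z.of_nat (nat_div (packed n) (base n)) = (b + Z.of_nat (den n))%Z.
Proof.
  intros Hn Hp.
  assert (HB : base n <> 0) by (unfold base; lia).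
  assert (HM : Z.of_nat (den n) = (5 ^ Z.of_nat n)%Z) by (unfold den; now rewrite Nat2Z.inj_pow).
  rewrite <- HM in Hn.
  assert (HBM : Z.of_nat (base n) = (2 * Z.of_nat (den n) + 1)%Z) by (unfold base; lia).
  assert (Hpk : Z.of_nat (packed n) = ((a + Z.of_nat (den n)) + (b + Z.of_nat (den n)) * Z.of_nat (base n))%Z).
  { unfold packed. rewrite nat_mod_eq by lia.
    rewrite Nat2Z.inj_mod, !Nat2Z.inj_add, Nat2Z.inj_pow, Nat2Z.inj_add, !Nat2Z.inj_mul.
    change (Z.of_nat 3) with 3%Z. change (Z.of_nat 4) with 4%Z. change (Z.of_nat 1) with 1%Z.
    rewrite Hp. symmetry. apply (Z.mod_unique_pos _ _ t); [|ring].
    rewrite HBM. generalize dependent (Z.of_nat (den n)). clear. intros M Hn _ HB.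
    assert (-M <= a <= M)%Z by nia. assert (-M <= b <= M)%Z by nia. nia. }
  rewrite nat_mod_eq, nat_div_eq by assumption.
  rewrite Nat2Z.inj_mod, Nat2Z.inj_div, Hpk.
  assert (0 <= Z.of_nat (den n))%Z by lia.
  assert (0 <= a + Z.of_nat (den n) < Z.of_nat (base n))%Z by nia.
  split.
  - rewrite Z.mod_add by lia. now apply Z.mod_small.
  - rewrite Z.div_add by lia. rewrite Z.div_small by assumption. reflexivity.
Qed.

Definition quat_code (A B M : nat) : nat :=
  npair (npair (npair A (M - 1)) (npair B (M - 1))) (npair (npair 0 (M - 1)) (npair 0 (M - 1))).

Definition power_code (n : nat) : nat :=
  quat_code (code_shifted (nat_mod (packed n) (base n)) (den n))
    (code_shifted (nat_div (packed n) (base n)) (den n)) (den n).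

(** Inversion negates the imaginary coordinate, which amounts to exchanging the arguments of
    [code_shifted]. *)
Definition inverse_power_code (n : nat) : nat :=
  quat_code (code_shifted (nat_mod (packed n) (base n)) (den n))
    (code_shifted (den n) (nat_div (packed n) (base n))) (den n).

Lemma encQuat_power n : encQuat (fquat (expand (xpow n))) = power_code n /\
  encQuat (fquat (expand (winv (xpow n)))) = inverse_power_code n.
Proof.
  destruct (gauss_power n (Z.of_nat (base n))) as (a & b & t & H1 & H2 & H3 & H4).
  destruct (packed_digits n a b t H3 H4) as [Ha Hb].
  apply code_shifted_encZ in Ha, Hb. destruct Ha as [Ha _], Hb as [Hb Hb'].
  assert (Hd : Pos.to_nat (Z.to_pos (5 ^ Z.of_nat n)) = den n).
  { unfold den. rewrite <- Z2Nat.inj_pos, Z2Pos.id by (apply Z.pow_pos_nonneg; lia).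
    rewrite Z2Nat.inj_pow by lia. now rewrite Nat2Z.id. }
  rewrite expand_xpow, expand_winv_xpow.
  unfold power_code, inverse_power_code, quat_code, fquat. rewrite !repeat_length, H1, H2.
  unfold encQuat, encQ; cbn [ra rb rc rd za zb zc zd Qnum Qden].
  rewrite Hd, Ha, Hb, Hb'. split; reflexivity.
Qed.

(** The input occurs both in the exponent $2^x$ and, in last place, as the code of the tail of the
    instance. *)
Definition input_code (c c' x : nat) : nat :=
  S (npair (npair (power_code (2 ^ x)) c) (S (npair (npair (inverse_power_code (2 ^ x)) c') x))).

Lemma computable_input_code c c' : computable 1 (fun f => input_code c c' (f 0)).
Proof.
  unfold input_code, power_code, inverse_power_code, quat_code, code_shifted, packed, base, den.
  repeat first [apply computable_succ | apply computable_npair | apply computable_mod | apply computable_div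
    | apply computable_add | apply computable_sub | apply computable_mul | apply computable_pow
    | apply (computable_reg 1 0 (le_n 1)) | apply computable_const].
Qed.

Definition y_code : nat := encQuat (fquat (expand yl)).
Definition y_inverse_code : nat := encQuat (fquat (expand (winv yl))).

Definition start_pairs (x : nat) : list wpair := both_signs [start_rel (2 ^ x)].

Lemma encode_cons p L : encode (p :: L) =
  S (npair (npair (encQuat (fst p)) (encQuat (snd p))) (encode L)).
Proof. reflexivity. Qed.

Lemma encode_start x T : encode (pair_instance (start_pairs x ++ T)) =
  S (npair (npair (power_code (2 ^ x)) y_code)
    (S (npair (npair (inverse_power_code (2 ^ x)) y_inverse_code) (encode (pair_instance T))))).
Proof.
  destruct (encQuat_power (2 ^ x)) as [E1 E2]. rewrite <- E1, <- E2.
  unfold pair_instance, start_pairs, both_signs, start_rel, y_code, y_inverse_code.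
  cbn [flat_map app map fst snd]. rewrite !encode_cons. cbn [fst snd]. reflexivity.
Qed.

(** * The diagonal program *)

Lemma machine_instances (D : program) : exists T : list wpair, forall x,
  semigroup_is_group (instance_gens (pair_instance (start_pairs x ++ T))) <->
  exists k, halted D (steps D k (init x)).
Proof.
  assert (HR : exists R, 0 < R /\ forall i, In i D -> reg_of i < R).
  { induction D as [|i D (R & R1 & R2)]; [exists 1; split; [lia|intros _ []]|].
    exists (S (reg_of i) + R). split; [lia|]. intros j [<-|Hj]; [lia|]. specialize (R2 j Hj). lia. }
  destruct HR as (R & R1 & R2).
  (* The start relation is listed first, so its two pairs head the generators; what follows does not
     depend on [x]. *)
  exists (both_signs (rules_rels (modulus D + len D) (machine_rules D R))
    ++ both_signs (diagonal (4 + length (machine_rules D R))) ++ [(test_word (modulus D), [])]).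
  intros x. rewrite <- (machine_group D R R2 R1 x). reflexivity.
Qed.

(** Jumps out of the program, however far past its end, are redirected to the instruction directly
    after it. *)
Definition relocate (o l : nat) (i : instr) : instr :=
  match i with INC r => INC r | DEC r j => DEC r (o + Nat.min j l) end.

Lemma relocate_correct (P u v : program) n : forall pc f,
  let c := steps P n (pc, f) in
  reaches (u ++ map (relocate (length u) (length P)) P ++ v)
    (length u + Nat.min pc (length P), f) (length u + Nat.min (fst c) (length P), snd c).
Proof.
  induction n as [|n IH]; intros pc f; cbn [steps].
  - exists 0. reflexivity.
  - destruct (step P (pc, f)) as [[pc' f']|] eqn:E; [|exists 0; reflexivity].
    eapply reaches_trans; [|apply IH]. apply reaches_step.
    unfold step in E |- *. destruct (nth_error P pc) as [i|] eqn:Ei; [|discriminate].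
    assert (Hpc : pc < length P) by (apply nth_error_Some; congruence).
    rewrite Nat.min_l by lia.
    rewrite nth_error_app2, nth_error_app1 by (rewrite ?length_map; lia).
    replace (length u + pc - length u) with pc by lia.
    rewrite nth_error_map, Ei. cbn [option_map].
    destruct i as [r|r j]; cbn [relocate].
    + injection E as <- <-. f_equal. f_equal. lia.
    + destruct (f r) as [|k]; injection E as <- <-; f_equal; f_equal; lia.
Qed.

Lemma steps_other_register P z n : (forall i, In i P -> reg_of i < z) ->
  forall pc f, snd (steps P n (pc, f)) z = f z.
Proof.
  intros Hz. induction n as [|n IH]; intros pc f; cbn [steps]; [reflexivity|].
  destruct (step P (pc, f)) as [[pc' f']|] eqn:E; [|reflexivity]. rewrite IH.
  unfold step in E. destruct (nth_error P pc) as [i|] eqn:Ei; [|discriminate].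
  apply nth_error_In, Hz in Ei. destruct i as [r|r j]; cbn [reg_of] in Ei.
  - injection E as <- <-. rewrite update_other by lia. reflexivity.
  - destruct (f r) as [|k]; injection E as <- <-; [reflexivity|]. now rewrite update_other by lia.
Qed.

(** * Negating the answer of a program *)

Section Flip.
Variables (u : program) (z : nat).
Hypothesis z_pos : 0 < z.
Let e := length u.
(** With register 0 empty, the first added instruction jumps past the end and the program halts.
    Otherwise the decrement is undone and, [z] being empty, the last instruction jumps back
    forever. *)
Let D := u ++ [DEC 0 (e + 3); INC 0; DEC z e].

Lemma flip_nth k : nth_error D (e + k) = nth_error [DEC 0 (e + 3); INC 0; DEC z e] k.
Proof. unfold D, e. rewrite nth_error_app2 by lia. f_equal. lia. Qed.

Lemma flip_halts f : f 0 = 0 -> exists k, halted D (steps D k (e, f)).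
Proof.
  intros H0. exists 1. assert (N := flip_nth 0). rewrite Nat.add_0_r in N.
  cbn [steps]. unfold step at 1. rewrite N; cbn [nth_error]. rewrite H0.
  unfold halted, step. now rewrite flip_nth.
Qed.

Definition looping (c : config) : Prop := snd c z = 0 /\
  ((fst c = e /\ snd c 0 <> 0) \/ fst c = e + 1 \/ (fst c = e + 2 /\ snd c 0 <> 0)).

Lemma looping_step c : looping c -> exists c', step D c = Some c' /\ looping c'.
Proof.
  destruct c as [pc f]; unfold looping; cbn [fst snd]. intros [Hz [[-> H0] | [-> | [-> H0]]]].
  - assert (N := flip_nth 0). rewrite Nat.add_0_r in N. unfold step. rewrite N; cbn [nth_error].
    destruct (f 0) as [|k]; [congruence|]. eexists. split; [reflexivity|]. cbn [fst snd].
    rewrite update_other by lia. split; [assumption|]. right; left. lia.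
  - unfold step. rewrite flip_nth; cbn [nth_error]. eexists. split; [reflexivity|]. cbn [fst snd].
    rewrite update_other by lia. split; [assumption|]. right; right. rewrite update_same. lia.
  - unfold step. rewrite flip_nth; cbn [nth_error]. rewrite Hz. eexists. split; [reflexivity|]. cbn [fst snd]. auto.
Qed.

Lemma looping_forever c k : looping c -> ~ halted D (steps D k c).
Proof.
  revert c. induction k as [|k IH]; intros c Hc; destruct (looping_step c Hc) as (c' & E & Hc').
  - cbn. unfold halted. congruence.
  - cbn [steps]. rewrite E. now apply IH.
Qed.

End Flip.

Lemma halting_reaches P c d : reaches P c d ->
  (exists k, halted P (steps P k c)) <-> (exists k, halted P (steps P k d)).
Proof.
  intros [n <-]. split; intros [k Hk].
  - exists k. rewrite <- steps_add, Nat.add_comm, steps_add.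
    now rewrite (steps_halted P n _ Hk).
  - exists (n + k). now rewrite steps_add.
Qed.

(** The program is made of code for [h], a relocated copy of [P], and the loop that halts only when
    register 0 is empty. *)
Lemma diagonal_program (P : program) (h : nat -> nat) : computable 1 (fun f => h (f 0)) ->
  exists D, forall x y, outputs P (h x) y -> (exists k, halted D (steps D k (init x))) <-> y = 0.
Proof.
  intros [_ Hc]. destruct (Hc 1 (le_n 1)) as [c0 Hc0].
  (* The value is computed into register 1 and moved to register 0, which leaves the initial
     registers of [P] on [h x]. *)
  set (c := Seq c0 (Seq (Loop 0 Skip) (Loop 1 (Inc 0)))).
  (* The register [z] lies above all those of [c] and [P], so it stays 0 and can carry the
     unconditional jumps. *)
  assert (HP : exists z, 0 < z /\ regs_bound c <= z /\ forall i, In i P -> reg_of i < z).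
  { clear. induction P as [|i P (z & Z1 & Z2 & Z3)].
    - exists (S (regs_bound c)). repeat split; [lia|lia|intros _ []].
    - exists (S (reg_of i) + z). repeat split; [lia|lia|].
      intros j [<-|Hj]; [lia|]. specialize (Z3 j Hj). lia. }
  destruct HP as (z & Z1 & Z2 & Z3).
  set (u1 := compile z 0 c). set (u2 := map (relocate (length u1) (length P)) P).
  set (u := u1 ++ u2). set (D := u ++ [DEC 0 (length u + 3); INC 0; DEC z (length u)]).
  exists D. intros x y [n [Hn Hy]].
  assert (Hrun : runs c (snd (init x)) (snd (init (h x)))).
  { unfold c. eapply runs_seq.
    - apply Hc0. intros [|r] Hr; [lia|reflexivity].
    - eapply runs_seq; [apply runs_clear|]. eapply runs_eq; [apply runs_move; lia|].
      cbn [init snd]. state_eq. }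
  destruct (compile_correct z _ _ _ Hrun Z2) as [_ Hcomp].
  { cbn [init snd]. destruct (Nat.eqb_spec z 0); lia. }
  specialize (Hcomp [] (u2 ++ [DEC 0 (length u + 3); INC 0; DEC z (length u)])).
  cbn [app length Nat.add] in Hcomp. fold u1 in Hcomp.
  assert (ED : D = u1 ++ u2 ++ [DEC 0 (length u + 3); INC 0; DEC z (length u)]).
  { unfold D, u. now rewrite <- app_assoc. }
  rewrite <- ED in Hcomp.
  assert (Hrel := relocate_correct P u1 [DEC 0 (length u + 3); INC 0; DEC z (length u)] n 0 (snd (init (h x)))).
  cbv zeta in Hrel. fold u2 in Hrel. rewrite <- ED in Hrel. cbn [Nat.min] in Hrel.
  change (0, snd (init (h x))) with (init (h x)) in Hrel.
  set (d := steps P n (init (h x))) in *.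
  assert (Hlen : length u1 + Nat.min (fst d) (length P) = length u).
  { unfold u, u2. rewrite length_app, length_map. f_equal. apply Nat.min_r.
    unfold halted in Hn. destruct d as [pc f]. unfold step in Hn; cbn [fst].
    destruct (nth_error P pc) as [[r|r j]|] eqn:E; [discriminate|destruct (f r); discriminate|].
    now apply nth_error_None. }
  rewrite Hlen, Nat.add_0_r in Hrel. unfold u1 in Hrel at 1. rewrite compile_length in Hrel.
  assert (Hreach : reaches D (init x) (length u, snd d)) by (eapply reaches_trans; eassumption).
  rewrite (halting_reaches _ _ _ Hreach).
  split.
  - intros [k Hk]. destruct (Nat.eq_dec y 0) as [H0|H0]; [assumption|]. exfalso.
    refine (looping_forever u z Z1 _ k _ Hk). split; cbn [fst snd].
    + unfold d, init. rewrite steps_other_register by assumption. destruct (Nat.eqb_spec z 0); lia.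
    + left. split; [reflexivity|]. congruence.
  - intros ->. now apply flip_halts.
Qed.

Theorem mainTheorem8 :
  ~ exists P : program,
      decides P (fun S => semigroup_is_group (instance_gens S)).
Proof.
  intros [P HP].
  destruct (diagonal_program P (input_code y_code y_inverse_code)) as [D HD];
    [apply computable_input_code|].
  destruct (machine_instances D) as [T HT].
  (* With the code of its own tail as input, [input_code] is exactly the code of the instance below.
     This instance generates a group if and only if [D] halts, and [D] halts if and only if [P]
     denies that it does. *)
  set (x := encode (pair_instance T)).
  destruct (HP (pair_instance (start_pairs x ++ T)) (pair_instance_valid _)) as (y & Hy & Hgroup).
  rewrite encode_start in Hy. specialize (HD x y Hy). specialize (HT x). cbv beta in Hgroup.
  tauto.
Qed.
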